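(* Let $\Gamma$ be a non-elementary discrete group acting properly by isometries on a proper roughly geodesic hyperbolic space $(X,d)$, and let $\nu$ be a probability measure on the Gromov boundary $\partial X$ of $(X,d)$. Assume that $\mu$ is a symmetric, non-elementary, $\nu$-ergodic probability measure on $\Gamma$ with 1st moment. Let $(X_n)_n$ be the $\mu$-random walk on $\Gamma$ starting at the identity. Then for all continuous functions $\varphi,\psi\in C^0(\partial X)$ and all $\xi,\eta\in\partial X$, $$\mathbb{E}^\mu[\varphi(X_n.\xi)\,\psi(X_n^{-1}.\eta)]=\sum_{g\in\Gamma}\varphi(g\xi)\,\psi(g^{-1}\eta)\,\mu^{*n}(g)\xrightarrow[n\to+\infty]{}\int_{\partial X}\varphi\,d\nu\int_{\partial X}\psi\,d\nu .$$
   Context: Fix a basepoint $o\in X$. Hyperbolic means Gromov hyperbolic: with $(x|y)_w=\frac12(d(x,w)+d(y,w)-d(x,y))$, there is $\delta\ge 0$ with $(x|y)_w\ge\min\{(x|z)_w,(z|y)_w\}-\delta$ for all $x,y,z,w\in X$. Roughly geodesic means there is a constant $C$ such that any two points $x,y\in X$ are joined by a map $p:[0,T]\to X$ with $p(0)=x$, $p(T)=y$ and $|t-t'|-C\le d(p(t),p(t'))\le|t-t'|+C$ for all $t,t'\in[0,T]$. The Gromov boundary $\partial X$ is the compact space of equivalence classes of sequences $(x_n)$ in $X$ with $(x_n|x_m)_o\to+\infty$ as $n,m\to\infty$, where $(a_n)\sim(b_n)$ if $(a_n|b_m)_o\to+\infty$; $\Gamma$ acts on it continuously. A group is non-elementary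 if it is not virtually cyclic. A probability measure $\mu$ on $\Gamma$ is symmetric if $\mu(g)=\mu(g^{-1})$ for all $g\in\Gamma$; a symmetric $\mu$ is non-elementary if the semigroup generated by its support (which is a group, by symmetry) is non-elementary; $\mu$ has a 1st moment if $\sum_{g\in\Gamma}d(g.o,o)\mu(g)<\infty$. For a continuous action of $\Gamma$ on a compact space $K$ (here $K=\partial X$), the Markov operator $P_\mu$ on $C^0(K)$ is $P_\mu\varphi(\xi)=\sum_{g\in\Gamma}\mu(g)\varphi(g\xi)$. A probability measure $\nu$ on $K$ is $\mu$-stationary if $\mu*\nu=\sum_{g}\mu(g)\,g_*\nu=\nu$. The measure $\mu$ is $\nu$-ergodic if $\nu$ is $\mu$-stationary and every $P_\mu$-invariant function is $\nu$-almost everywhere constant. The $\mu$-random walk starting at the identity is $X_n=H_1\cdots H_n$ with $(H_i)$ independent of law $\mu$; the law of $X_n$ is the convolution power $\mu^{*n}$. *)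

(* Defs.v *)
From HB Require Import structures.
From mathcomp Require Import all_boot all_order all_algebra.
From mathcomp Require Import finmap lra.
From mathcomp Require Import all_classical all_reals all_analysis.

Set Implicit Arguments.
Unset Strict Implicit.
Unset Printing Implicit Defensive.
Import Order.TTheory GRing.Theory Num.Theory.
Import numFieldNormedType.Exports.
Local Open Scope classical_set_scope.
Local Open Scope ring_scope.

Section HyperbolicSpace.
Context {R : realType} {X : metricType R}.

Definition gromov_product (w x y : X) : R :=
  (mdist x w + mdist y w - mdist x y) / 2.

Definition hyperbolic : Prop :=
  exists2 delta : R, 0 <= delta &
    forall x y z w : X,
      Num.min (gromov_product w x z) (gromov_product w z y) - delta
        <= gromov_product w x y.

Definition roughly_geodesic : Prop :=
  exists C : R, forall x y : X, exists (T : R) (p : R -> X),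
    [/\ 0 <= T, p 0 = x, p T = y &
      forall t t' : R, t \in `[0, T] -> t' \in `[0, T] ->
        `|t - t'| - C <= mdist (p t) (p t') <= `|t - t'| + C].

Definition proper_space : Prop :=
  forall (x : X) (r : R), compact [set y : X | mdist x y <= r].

(* [(x_n | y_m)_o] tends to [+oo] as [n] and [m] tend to infinity
   independently. *)
Definition gromov_equiv (o : X) (x y : nat -> X) : Prop :=
  gromov_product o (x p.1) (y p.2) @[p --> filter_prod \oo \oo] --> +oo.

Definition gromov_seq (o : X) (x : nat -> X) : Prop := gromov_equiv o x x.

(* A boundary point is an equivalence class, encoded as a set of sequences. *)
Record boundary (o : X) := Boundary {
  bclass : set (nat -> X) ;
  bclassP : exists2 x, gromov_seq o x &
    bclass = [set y | gromov_seq o y /\ gromov_equiv o x y]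
}.

HB.instance Definition _ (o : X) := gen_eqMixin (boundary o).
HB.instance Definition _ (o : X) := gen_choiceMixin (boundary o).

(* (xi | eta)_o = sup liminf_{n,m} (x_n | y_m)_o over representatives. *)
Definition boundary_product (o : X) (xi eta : boundary o) : \bar R :=
  ereal_sup [set l | exists x y : nat -> X, [/\ bclass xi x, bclass eta y &
    l = limf_einf (fun p : nat * nat => (gromov_product o (x p.1) (y p.2))%:E)
          (filter_prod \oo \oo)]].

(* The topology in which the sets {eta | (xi | eta)_o > r}, r : R, generate the
   neighbourhoods of xi. *)
Definition boundary_open (o : X) (U : set (boundary o)) : Prop :=
  forall xi, U xi -> exists r : R,
    [set eta | (r%:E < boundary_product xi eta)%E] `<=` U.

Lemma boundary_openT (o : X) : boundary_open [set: boundary o].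
Proof. by move=> xi _; exists 0. Qed.

Lemma boundary_openI (o : X) : setI_closed (@boundary_open o).
Proof.
move=> U V oU oV xi [/oU [r rU] /oV [s sV]].
exists (Num.max r s) => eta /=; rewrite EFin_max gt_max => /andP[rxi sxi].
by split; [exact: rU|exact: sV].
Qed.

Lemma boundary_open_bigU (o : X) (I : Type) (f : I -> set (boundary o)) :
  (forall i, boundary_open (f i)) -> boundary_open (\bigcup_i f i).
Proof.
by move=> fo xi [i _ /fo [r rf]]; exists r => eta /rf; exists i.
Qed.

HB.instance Definition _ (o : X) := isOpenTopological.Build (boundary o)
  (@boundary_openT o) (@boundary_openI o) (@boundary_open_bigU o).

(* The boundary with its Borel sigma-algebra. Measurable types are pointed in
   the library, so the type carries a witness of nonemptiness; nothing else
   depends on [xi0]. *)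
Definition borel_boundary (o : X) (xi0 : boundary o) : Type := boundary o.

HB.instance Definition _ (o : X) (xi0 : boundary o) :=
  Choice.on (borel_boundary xi0).
HB.instance Definition _ (o : X) (xi0 : boundary o) :=
  isPointed.Build (borel_boundary xi0) xi0.
HB.instance Definition _ (o : X) (xi0 : boundary o) :=
  Measurable.copy (borel_boundary xi0)
    (g_sigma_algebraType
      ((@open (boundary o)) : set (set (borel_boundary xi0)))).

End HyperbolicSpace.
Arguments hyperbolic {R} X.
Arguments roughly_geodesic {R} X.
Arguments proper_space {R} X.

Record isom_action {R : realType} (G : groupType) (X : metricType R) :=
  IsomAction {
    act :> G -> X -> X ;
    act1 : forall x, act 1%g x = x ;
    actM : forall g h x, act (g * h)%g x = act g (act h x) ;
    act_isom : forall g x y, mdist (act g x) (act g y) = mdist x y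
  }.

Section Action.
Context {R : realType} {G : groupType} {X : metricType R}.
Variable a : isom_action G X.

(* [G] is discrete: finitely many [g] move a compact set to meet itself. *)
Definition proper_action : Prop :=
  forall K : set X, compact K -> finite_set [set g | a g @` K `&` K !=set0].

Lemma actK g : cancel (a g) (a g^-1%g).
Proof. by move=> x; rewrite -actM mulVg act1. Qed.

Lemma actKV g : cancel (a g^-1%g) (a g).
Proof. by move=> x; rewrite -actM mulgV act1. Qed.

Lemma gromov_product_act o g x y :
  gromov_product o x y - mdist o (a g o) <= gromov_product o (a g x) (a g y).
Proof.
rewrite /gromov_product act_isom.
have := metric_triangle (a g x) o (a g o).
have := metric_triangle (a g y) o (a g o).
rewrite !act_isom; lra.
Qed.

Lemma gromov_equiv_act o g x y :
  gromov_equiv o x y -> gromov_equiv o (a g \o x) (a g \o y).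
Proof.
move=> /cvgryPge xy; apply/cvgryPge => A.
near=> p; apply: le_trans (gromov_product_act o g _ _).
rewrite lerBrDr; near: p; exact: xy.
Unshelve. all: by end_near. Qed.

Lemma gromov_equiv_actV o g x y :
  gromov_equiv o (a g \o x) y -> gromov_equiv o x (a g^-1%g \o y).
Proof.
move=> /(gromov_equiv_act g^-1%g).
by congr (gromov_equiv o _ _); apply/funext => n /=; rewrite actK.
Qed.

Lemma boundary_actP o g (xi : boundary o) :
  exists2 x, gromov_seq o x & [set a g \o y | y in bclass xi] =
    [set y | gromov_seq o y /\ gromov_equiv o x y].
Proof.
have [x gx ->] := bclassP xi.
exists (a g \o x); first exact: gromov_equiv_act.
apply/seteqP; split => [_ [y [gy xy]] <-|y [gy xy]] /=.
  by split; exact: gromov_equiv_act.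
exists (a g^-1%g \o y); last by apply/funext => n /=; rewrite actKV.
by split; [exact: gromov_equiv_act|exact: gromov_equiv_actV].
Qed.

Definition boundary_act (o : X) (g : G) (xi : boundary o) : boundary o :=
  Boundary (boundary_actP g xi).

End Action.

Section DiscreteGroup.
Context {R : realType} {G : groupType}.
Implicit Types (mu : G -> R) (S : set G).

(* Sum of an absolutely summable real family, as positive part minus negative
   part. *)
Definition gsum (f : G -> R) : R :=
  fine (\esum_(g in [set: G]) (Num.max (f g) 0)%:E)%E -
  fine (\esum_(g in [set: G]) (Num.max (- f g) 0)%:E)%E.

Definition cyclic_subgroup (h : G) : set G :=
  [set g | exists k : nat, g = (h ^+ k)%g \/ g = (h ^- k)%g].

(* For a subgroup [S]: finitely many left cosets of some cyclic subgroup of [S]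
   cover [S]. *)
Definition virtually_cyclic S : Prop :=
  exists2 h, S h & exists2 F : set G, finite_set F &
    S `<=` [set (r * c)%g | r in F & c in cyclic_subgroup h].

Definition generated_semigroup S : set G :=
  smallest [set A | forall g h, A g -> A h -> A (g * h)%g] S.

Definition probability_on mu : Prop :=
  (forall g, 0 <= mu g) /\ (\esum_(g in [set: G]) (mu g)%:E = 1)%E.

Definition symmetric_measure mu : Prop := forall g, mu g = mu g^-1%g.

Definition support_of mu : set G := [set g | mu g != 0].

Definition nonelementary_measure mu : Prop :=
  ~ virtually_cyclic (generated_semigroup (support_of mu)).

Definition convolution mu mu' : G -> R :=
  fun g => gsum (fun h => mu h * mu' (h^-1 * g)%g).

Definition convolution_power mu (n : nat) : G -> R :=
  iter n (fun mu' => convolution mu' mu) (fun g => (g == 1%g)%:R).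

Section RandomWalk.
Context {d : measure_display} {Omega : measurableType d}.
Variable P : probability Omega R.

(* Every subset of the discrete group is measurable. *)
Definition iid_with_law mu (H : nat -> Omega -> G) : Prop :=
  [/\ forall i (A : set G), measurable (H i @^-1` A),
      forall i g, P (H i @^-1` [set g]) = (mu g)%:E &
      forall (I : {fset nat}) (A : nat -> set G),
        P (\bigcap_(i in [set` I]) H i @^-1` A i) =
        (\prod_(i <- I) P (H i @^-1` A i))%E].

(* The increments H_1, H_2, ... are indexed from 0. *)
Definition random_walk (H : nat -> Omega -> G) (n : nat) (w : Omega) : G :=
  (\prod_(i < n) H i w)%g.

End RandomWalk.
End DiscreteGroup.

Section BoundaryMeasures.
Context {R : realType} {G : groupType} {X : metricType R}.
Variables (a : isom_action G X) (o : X) (mu : G -> R).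

Definition first_moment : Prop :=
  (\esum_(g in [set: G]) (mdist (a g o) o * mu g)%:E < +oo)%E.

Definition markov (f : boundary o -> R) : boundary o -> R :=
  fun xi => gsum (fun g => mu g * f (boundary_act a g xi)).

Variables (xi0 : boundary o) (nu : probability (borel_boundary xi0) R).

Definition stationary : Prop :=
  forall A : set (borel_boundary xi0), measurable A ->
    (\esum_(g in [set: G]) ((mu g)%:E * nu (boundary_act a g @^-1` A)) = nu A)%E.

(* Invariance is that of L^oo(nu): [f] is bounded Borel and [markov f = f]
   almost everywhere. *)
Definition ergodic_for : Prop :=
  stationary /\
  forall f : borel_boundary xi0 -> R,
    measurable_fun setT f -> (exists M : R, forall xi, `|f xi| <= M) ->
    (\forall xi \ae nu, markov f xi = f xi) ->
    exists c : R, \forall xi \ae nu, f xi = c.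

End BoundaryMeasures.

(* Main.v *)
Require Import Defs.
From HB Require Import structures.
From mathcomp Require Import all_boot all_order all_algebra.
From mathcomp Require Import finmap ring lra.
From mathcomp Require Import all_classical all_reals all_analysis.
From mathcomp Require Import measurable_realfun.

Set Implicit Arguments.
Unset Strict Implicit.
Unset Printing Implicit Defensive.
Import Order.TTheory GRing.Theory Num.Theory.
Import numFieldNormedType.Exports.
Local Open Scope classical_set_scope.
Local Open Scope ring_scope.

(* Write [mu_n] for the [n]-th convolution power of [mu] and [Gamma] for the
   group generated by its support. The theorem follows from a uniform
   contraction property: for continuous [phi], the mean of [|phi (g xi) - phi
   (g eta)|] under [mu_n] tends to [0] uniformly in [xi] and [eta]. Splitting
   [X_n = g h] at half time, [g h xi] may be replaced by [g xi] and [(g h)^-1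
   eta] by [h^-1 eta], which are independent; stationarity identifies the limit
   of each factor. Since [(g xi | g eta)_o = (xi | eta)_(g^-1 o)], contraction
   holds once [mu_n] gives asymptotically no mass to the elements [g] with [g
   o] near a ray from [o], uniformly over the rays. If [nu] has no atom,
   compactness makes all small balls of the boundary have small mass, and [nu
   (B) = sum_g mu_n(g) nu (g^-1 B)] for a small ball [B] around [xi] bounds the
   mass of the [g] with [g o] far out near that ray. If [nu] has atoms, those
   of maximal mass form a finite invariant set. As [Gamma] is not virtually
   cyclic, it must then fix a boundary point and quasi-preserve the horospheres
   there, so a ray comes near boundedly many orbit points, while [sup_g
   mu_n(g)] tends to [0] because [Gamma] is infinite. *)

(** Atoms cannot be excluded: a copy of Z^2 acting by parabolic isometries of hyperbolic 3-space is
    not virtually cyclic, and the point mass at its fixed point is stationary. There [nu] gives no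
    information on where the walk goes, and the spreading of [mu_n] over the group has to take its
    place; hence the two proofs behind [ray_vanish]. Contraction must be uniform in both points
    because, once the walk is cut, the points [h xi] and [g^-1 eta] to which it is applied depend on
    the other factor. Symmetry is essential: whether [g] contracts is decided by the position of
    [g^-1 o], and [X_n^-1] has to contract as well as [X_n]; both are settled by the invariance of
    [mu_n] under inversion. No metric is put on the boundary. Nearness is an eventual lower bound on
    Gromov products along all representatives, each use of hyperbolicity costs a multiple of
    [delta], and compactness enters only as the existence of cluster points of sequences. *)

Section EsumExtra.
Context {R : realType}.
Local Open Scope ereal_scope.

Lemma esum_swap (T1 T2 : choiceType) (F : T1 -> T2 -> \bar R) :
  (forall i j, 0 <= F i j) ->
  \esum_(i in [set: T1]) \esum_(j in [set: T2]) F i j =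
  \esum_(j in [set: T2]) \esum_(i in [set: T1]) F i j.
Proof.
move=> F0; rewrite !esum_esum//.
rewrite (reindex_esum ([set: T2] `*`` fun=> [set: T1]) _ (fun x => (x.2,
  x.1)))//.
by split=> [[i j] []//|[i1 i2] [j1 j2] /= _ _ [-> ->]//|[i j] _]; exists (j, i).
Qed.

Lemma esumZl (T : choiceType) (c : R) (F : T -> \bar R) :
  (0 <= c)%R -> (forall i, 0 <= F i) ->
  \esum_(i in [set: T]) (c%:E * F i) = c%:E * \esum_(i in [set: T]) F i.
Proof.
have le (k : R) (f : T -> \bar R) : (0 <= k)%R -> (forall i, 0 <= f i) ->
    \esum_(i in [set: T]) (k%:E * f i) <= k%:E * \esum_(i in [set: T]) f i.
  move=> k0 f0; apply: ge_ereal_sup => _ [X [finX _] <-].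
  rewrite -ge0_mule_fsumr//; apply: lee_pmul => //.
    by rewrite fsume_ge0// => i _; exact: f0.
  by apply: ereal_sup_ubound; exists X.
move=> c0 F0; have [->|c1] := eqVneq c 0%R.
  by rewrite mul0e esum1// => i _; rewrite mul0e.
apply/eqP; rewrite eq_le le//=.
have cF i : F i = c^-1%:E * (c%:E * F i) by rewrite muleA -EFinM mulVf// mul1e.
rewrite (eq_esum (b := fun i => c^-1%:E * (c%:E * F i)) (fun i _ => cF i)).
have : (c%:E * (\esum_(i in [set: T]) (c^-1%:E * (c%:E * F i))) <=
    c%:E * (c^-1%:E * (\esum_(i in [set: T]) (c%:E * F i))))%E.
  apply: lee_pmul => //; first by apply: esum_ge0 => i _; rewrite -cF.
  by apply: le; rewrite ?invr_ge0// => i; rewrite mule_ge0.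
by rewrite [X in _ <= X]muleA -EFinM mulfV// mul1e.
Qed.

End EsumExtra.

(** * Means of bounded functions under a probability on the group *)

Definition bounded_fam {R : realType} (T : Type) (f : T -> R) : Prop :=
  exists M, forall t, `|f t| <= M.

Lemma bounded_famD {R : realType} T (f g : T -> R) :
  bounded_fam f -> bounded_fam g -> bounded_fam (fun t => f t + g t).
Proof.
move=> [M fM] [N gN]; exists (M + N) => t.
by rewrite (le_trans (ler_normD _ _))// lerD.
Qed.

Lemma bounded_famM {R : realType} T (f g : T -> R) :
  bounded_fam f -> bounded_fam g -> bounded_fam (fun t => f t * g t).
Proof.
move=> [M fM] [N gN]; exists (M * N) => t.
by rewrite normrM ler_pM.
Qed.

Lemma bounded_fam_abs {R : realType} T (f : T -> R) :
  bounded_fam f -> bounded_fam (fun t => `|f t|).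
Proof. by move=> [M fM]; exists M => t; rewrite normr_id. Qed.

Lemma bounded_famN {R : realType} T (f : T -> R) :
  bounded_fam f -> bounded_fam (fun t => - f t).
Proof. by move=> [M fM]; exists M => t; rewrite normrN. Qed.

Lemma bounded_famB {R : realType} T (f g : T -> R) :
  bounded_fam f -> bounded_fam g -> bounded_fam (fun t => f t - g t).
Proof. by move=> ? ?; apply: bounded_famD => //; exact: bounded_famN. Qed.

Lemma bounded_fam_cst {R : realType} T (c : R) : bounded_fam (fun _ : T => c).
Proof. by exists `|c|. Qed.

Lemma bounded_fam_comp {R : realType} T U (h : U -> T) (f : T -> R) :
  bounded_fam f -> bounded_fam (fun u => f (h u)).
Proof. by move=> [M fM]; exists M. Qed.

Lemma bounded_fam_bool {R : realType} T (P : pred T) :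
  bounded_fam (fun t => (P t)%:R : R).
Proof. by exists 1 => t; case: (P t); rewrite ?normr0 ?normr1. Qed.

Lemma bounded_fam_indic {R : realType} T (A : set T) :
  bounded_fam (\1_A : T -> R).
Proof. by exists 1 => t; rewrite indicE; case: (_ \in _);
  rewrite ?normr0 ?normr1. Qed.

(* Locked, so that rewriting with laws of sums does not unfold [gsum]. *)
HB.lock Definition ex {R : realType} {G : groupType} (p f : G -> R) : R :=
  gsum (fun g => f g * p g).

Section Expectation.
Context {R : realType} {G : groupType}.
Implicit Types (p q f : G -> R).

Lemma gsum_ge0 f : (forall g, 0 <= f g) ->
  gsum f = fine (\esum_(g in [set: G]) (f g)%:E).
Proof.
move=> f0; rewrite /gsum [X in _ - fine X]esum1 ?subr0; last first.
  by move=> g _; rewrite max_r// oppr_le0.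
by congr fine; apply: eq_esum => g _; rewrite max_l.
Qed.

Lemma eq_ex p f1 f2 : f1 =1 f2 -> ex p f1 = ex p f2.
Proof. by move=> /funext ->. Qed.

Section OneMeasure.
Variable p : G -> R.
Hypothesis p_prob : probability_on p.

Let p0 g : 0 <= p g. Proof. exact: p_prob.1. Qed.

Lemma esum_prob_le f M : (forall g, 0 <= f g <= M) ->
  (\esum_(g in [set: G]) (f g * p g)%:E <= M%:E)%E.
Proof.
move=> fM; have M0 : 0 <= M by have /andP[+ +] := fM 1%g; exact: le_trans.
rewrite -[leRHS]mule1 -p_prob.2 -esumZl//; apply: le_esum => g _.
by rewrite -EFinM lee_fin ler_wpM2r//; have /andP[] := fM g.
Qed.

Lemma esum_prob_fin f : (forall g, 0 <= f g) -> bounded_fam f ->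
  (\esum_(g in [set: G]) (f g * p g)%:E)%E \is a fin_num.
Proof.
move=> f0 [M fM]; rewrite ge0_fin_numE; last first.
  by apply: esum_ge0 => g _; rewrite lee_fin mulr_ge0.
apply: le_lt_trans (ltry M); apply: esum_prob_le => g.
by rewrite f0 (le_trans (ler_norm _)).
Qed.

Lemma exE_ge0 f : (forall g, 0 <= f g) -> bounded_fam f ->
  ((ex p f)%:E = \esum_(g in [set: G]) (f g * p g)%:E)%E.
Proof.
by move=> f0 bf; rewrite ex.unlock gsum_ge0 ?fineK ?esum_prob_fin// => g;
  rewrite mulr_ge0.
Qed.

Lemma ex_ge0 f : (forall g, 0 <= f g) -> 0 <= ex p f.
Proof.
move=> f0; rewrite ex.unlock gsum_ge0; last by move=> g; rewrite mulr_ge0.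
by apply/fine_ge0/esum_ge0 => g _; rewrite lee_fin mulr_ge0.
Qed.

Lemma exD_ge0 f1 f2 : (forall g, 0 <= f1 g) -> (forall g, 0 <= f2 g) ->
  bounded_fam f1 -> bounded_fam f2 ->
  ex p (fun g => f1 g + f2 g) = ex p f1 + ex p f2.
Proof.
move=> f10 f20 b1 b2; apply: EFin_inj; rewrite EFinD !exE_ge0//.
- rewrite -esumD//; last 2 first.
  + by move=> g _; rewrite lee_fin mulr_ge0.
  + by move=> g _; rewrite lee_fin mulr_ge0.
  by apply: eq_esum => g _; rewrite mulrDl EFinD.
- by move=> g; rewrite addr_ge0.
- exact: bounded_famD.
Qed.

Lemma bounded_fam_maxr f : bounded_fam f -> bounded_fam (fun g => Num.max (f g)
  0).
Proof.
move=> [M fM]; exists M => g; rewrite ger0_norm ?le_max ?lexx ?orbT//.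
by rewrite ge_max (le_trans (ler_norm _)) ?fM//= (le_trans _ (fM 1%g)).
Qed.

Lemma ex_posneg f :
  ex p f = ex p (fun g => Num.max (f g) 0) - ex p (fun g => Num.max (- f g) 0).
Proof.
have mx0 (x : R) : 0 <= Num.max x 0 by rewrite le_max lexx orbT.
rewrite ex.unlock ![in RHS]gsum_ge0; last 2 first.
- by move=> g; rewrite mulr_ge0.
- by move=> g; rewrite mulr_ge0.
rewrite /gsum; congr (fine _ - fine _); apply: eq_esum => g _; congr EFin.
  by rewrite -[in LHS](mul0r (p g)) maxr_pMl.
by rewrite -[in LHS](mul0r (p g)) -mulNr maxr_pMl.
Qed.

(** The signed sum is defined by one particular splitting of [f = f1 - f2], into positive and
    negative parts. Any other splitting is compared with it through the identity
    [max f 0 + f2 = f1 + max (- f) 0] between nonnegative functions, where additivity is already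
    known. *)
Lemma exB_ge0 f1 f2 : (forall g, 0 <= f1 g) -> (forall g, 0 <= f2 g) ->
  bounded_fam f1 -> bounded_fam f2 ->
  ex p (fun g => f1 g - f2 g) = ex p f1 - ex p f2.
Proof.
move=> f10 f20 b1 b2; set f := fun g => _.
have bf : bounded_fam f by exact: bounded_famB.
rewrite ex_posneg; apply/eqP; rewrite subr_eq addrAC eq_sym subr_eq; apply/eqP.
have mx0 (x : R) : 0 <= Num.max x 0 by rewrite le_max lexx orbT.
rewrite -!exD_ge0//; first last.
- exact/bounded_fam_maxr/bounded_famN.
- exact/bounded_fam_maxr.
apply: eq_ex => g; rewrite /f; case: (lerP (f1 g) (f2 g)) => h.
  by rewrite (max_r (_ : f1 g - f2 g <= 0)) ?subr_le0// max_l ?oppr_ge0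
    ?subr_le0// opprB addrC subrK add0r.
by rewrite (max_l (_ : 0 <= f1 g - f2 g)) ?subr_ge0 ?ltW// max_r ?oppr_le0
  ?subr_ge0 ?ltW// addr0 subrK.
Qed.

Lemma exD f1 f2 : bounded_fam f1 -> bounded_fam f2 ->
  ex p (fun g => f1 g + f2 g) = ex p f1 + ex p f2.
Proof.
move=> b1 b2.
have mx0 (x : R) : 0 <= Num.max x 0 by rewrite le_max lexx orbT.
have posneg (x : R) : x = Num.max x 0 - Num.max (- x) 0.
  by case: (lerP x 0) => h; [rewrite max_l ?oppr_ge0//|rewrite max_r ?oppr_le0
    1?ltW//]; lra.
have bn1 := bounded_fam_maxr (bounded_famN b1).
have bn2 := bounded_fam_maxr (bounded_famN b2).
have bp1 := bounded_fam_maxr b1.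
have bp2 := bounded_fam_maxr b2.
rewrite (ex_posneg f1) (ex_posneg f2) addrACA -opprD -!exD_ge0// -exB_ge0//.
- by apply: eq_ex => g; rewrite {1}(posneg (f1 g)) {1}(posneg (f2 g)) opprD
  addrACA.
- by move=> g; rewrite addr_ge0.
- by move=> g; rewrite addr_ge0.
- exact: bounded_famD.
- exact: bounded_famD.
Qed.

Lemma exN f : ex p (fun g => - f g) = - ex p f.
Proof.
rewrite [LHS]ex_posneg [in RHS]ex_posneg opprB.
by congr (_ - _); apply: eq_ex => g; rewrite opprK.
Qed.

Lemma exB f1 f2 : bounded_fam f1 -> bounded_fam f2 ->
  ex p (fun g => f1 g - f2 g) = ex p f1 - ex p f2.
Proof. by move=> b1 b2; rewrite exD ?exN//; exact: bounded_famN. Qed.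

Lemma exZ_ge0 c f : 0 <= c -> (forall g, 0 <= f g) -> bounded_fam f ->
  ex p (fun g => c * f g) = c * ex p f.
Proof.
move=> c0 f0 bf; apply: EFin_inj; rewrite EFinM !exE_ge0//.
- rewrite -esumZl//; first by apply: eq_esum => g _; rewrite -mulrA EFinM.
  by move=> g; rewrite lee_fin mulr_ge0.
- by move=> g; rewrite mulr_ge0.
- by apply: bounded_famM => //; exact: bounded_fam_cst.
Qed.

Lemma ex_le f1 f2 : bounded_fam f1 -> bounded_fam f2 ->
  (forall g, f1 g <= f2 g) -> ex p f1 <= ex p f2.
Proof.
move=> b1 b2 f12; rewrite -subr_ge0 -exB//; apply: ex_ge0 => g.
by rewrite subr_ge0.
Qed.

Lemma ex_cst c : ex p (fun=> c) = c.
Proof.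
wlog c0 : c / 0 <= c.
  move=> h; have [|c0] := leP 0 c; first exact: h.
  rewrite -[c in LHS]opprK exN.
  by rewrite h ?opprK// oppr_ge0 ltW.
apply: EFin_inj; rewrite exE_ge0//; last exact: bounded_fam_cst.
by under eq_esum do rewrite EFinM; rewrite esumZl ?p_prob.2 ?mule1.
Qed.

Lemma exZ c f : bounded_fam f -> ex p (fun g => c * f g) = c * ex p f.
Proof.
move=> bf.
have mx0 (x : R) : 0 <= Num.max x 0 by rewrite le_max lexx orbT.
have bn := bounded_fam_maxr (bounded_famN bf).
have bp := bounded_fam_maxr bf.
have posneg (x : R) : x = Num.max x 0 - Num.max (- x) 0.
  by case: (lerP x 0) => h; [rewrite max_l ?oppr_ge0//|rewrite max_r ?oppr_le0
    1?ltW//]; lra.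
wlog c0 : c / 0 <= c.
  move=> h; have [|c0] := leP 0 c; first exact: h.
  transitivity (ex p (fun g => - (- c * f g))).
    by apply: eq_ex => g; rewrite mulNr opprK.
  rewrite exN.
  by rewrite h ?mulNr ?opprK// oppr_ge0 ltW.
have bcst := bounded_fam_cst G c.
rewrite (ex_posneg f) mulrBr -!exZ_ge0// -exB; last 2 first.
- exact/bounded_famM.
- exact/bounded_famM.
by apply: eq_ex => g; rewrite {1}(posneg (f g)) mulrBr.
Qed.

Lemma ex_abs f : bounded_fam f -> `|ex p f| <= ex p (fun g => `|f g|).
Proof.
move=> bf; have ba := bounded_fam_abs bf.
rewrite ler_norml -exN; apply/andP; split; apply: ex_le => //.
- exact: bounded_famN.
- by move=> g; rewrite lerNl -normrN ler_norm.
- by move=> g; rewrite ler_norm.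
Qed.

Lemma ex_bound f M : (forall g, `|f g| <= M) -> `|ex p f| <= M.
Proof.
move=> fM; have bf : bounded_fam f by exists M.
apply: (le_trans (ex_abs bf)); rewrite -[leRHS](ex_cst M).
by apply: ex_le => //; [exact: bounded_fam_abs|exact: bounded_fam_cst].
Qed.

Lemma ex_point x : ex p (fun g => (g == x)%:R) = p x.
Proof.
apply: EFin_inj; rewrite exE_ge0//; last first.
  by exists 1 => g; case: (g == x); rewrite ?normr1 ?normr0.
rewrite -[RHS](@esum_set1 _ _ x (EFin \o p)) ?lee_fin// [RHS]esum_mkcond.
apply: eq_esum => g _; rewrite in_set1; case: eqVneq => [->|] //=.
  by rewrite mul1r.
by rewrite mul0r.
Qed.

End OneMeasure.

Lemma ex_swap p q (F : G -> G -> R) : probability_on p -> probability_on q ->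
  bounded_fam (fun x : G * G => F x.1 x.2) ->
  ex p (fun g => ex q (F g)) = ex q (fun h => ex p (F^~ h)).
Proof.
move=> pp qq; have [p0 _] := pp; have [q0 _] := qq.
have ge0 (f : G -> G -> R) M : (forall g h, 0 <= f g h) ->
    (forall g h, `|f g h| <= M) ->
    ex p (fun g => ex q (f g)) = ex q (fun h => ex p (f^~ h)).
  move=> f0 fM; apply: EFin_inj.
  have bq g : bounded_fam (f g) by exists M.
  have bp h : bounded_fam (f^~ h) by exists M.
  rewrite !exE_ge0//; last 4 first.
  - by move=> h; apply: ex_ge0.
  - by exists M => h; apply: ex_bound.
  - by move=> g; apply: ex_ge0.
  - by exists M => g; apply: ex_bound.
  transitivity (\esum_(g in [set: G]) \esum_(h in [set: G])
      (f g h * q h * p g)%:E)%E.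
    apply: eq_esum => g _; rewrite EFinM exE_ge0// muleC -esumZl//.
      by apply: eq_esum => h _; rewrite -EFinM mulrC.
    by move=> h; rewrite lee_fin mulr_ge0.
  rewrite esum_swap; last by move=> g h; rewrite lee_fin !mulr_ge0.
  apply: eq_esum => h _; rewrite EFinM exE_ge0// muleC -esumZl//.
    by apply: eq_esum => g _; rewrite -EFinM mulrAC mulrC.
  by move=> g; rewrite lee_fin mulr_ge0.
move=> [M FM]; have FM' g h : `|F g h| <= M by exact: (FM (g, h)).
(* Adding the constant [M] makes [F] nonnegative, and both iterated means grow by exactly [M]. *)
have := @ge0 (fun g h => F g h + M) (M + M).
have bM := bounded_fam_cst G M.
rewrite (eq_ex _ (f2 := fun g => ex q (F g) + M)); last first.
  by move=> g; rewrite exD ?ex_cst//; exists M.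
rewrite exD ?ex_cst//; last by exists M => g; apply: ex_bound.
rewrite (@eq_ex q _ (fun h => ex p (F^~ h) + M)); last first.
  by move=> g; rewrite exD ?ex_cst//; exists M.
rewrite exD ?ex_cst//; last by exists M => g; apply: ex_bound.
move=> h; apply: (addIr M); apply: h => g h.
  by rewrite -lerBlDr sub0r; have := FM' g h; rewrite ler_norml => /andP[].
rewrite (le_trans (ler_normD _ _))// lerD// ger0_norm//.
exact: le_trans (FM' 1%g 1%g).
Qed.

Lemma convolution_ge0 p q : probability_on p -> probability_on q ->
  forall g, 0 <= convolution p q g.
Proof.
move=> [p0 _] [q0 _] g; rewrite /convolution gsum_ge0; last first.
  by move=> h; rewrite mulr_ge0.
by apply/fine_ge0/esum_ge0 => h _; rewrite lee_fin mulr_ge0.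
Qed.

Lemma prob_le1 p : probability_on p -> forall g, p g <= 1.
Proof.
move=> pp g; rewrite -lee_fin -pp.2.
rewrite -[leLHS](@esum_set1 _ _ g (EFin \o p)) ?lee_fin ?pp.1//=.
rewrite esum_mkcond; apply: le_esum => h _.
by case: ifP => // _; rewrite lee_fin pp.1.
Qed.

Lemma convolutionE p q : probability_on p -> probability_on q ->
  forall g, ((convolution p q g)%:E =
    \esum_(h in [set: G]) (p h * q (h^-1 * g)%g)%:E)%E.
Proof.
move=> pp qp g; have p0 := pp.1; have q0 := qp.1.
transitivity ((ex p (fun h => q (h^-1 * g)%g))%:E).
  rewrite ex.unlock /convolution; congr (gsum _)%:E; apply/funext => h.
  by rewrite mulrC.
rewrite exE_ge0//; first by apply: eq_esum => h _; rewrite mulrC.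
by exists 1 => h; rewrite ger0_norm// prob_le1.
Qed.

Lemma esum_convolution p q f : probability_on p -> probability_on q ->
  (forall g, 0 <= f g) ->
  (\esum_(g in [set: G]) (f g * convolution p q g)%:E =
  \esum_(h in [set: G]) \esum_(k in [set: G]) (f (h * k)%g * q k * p h)%:E)%E.
Proof.
move=> pp qp f0; have p0 := pp.1; have q0 := qp.1.
transitivity (\esum_(g in [set: G]) \esum_(h in [set: G])
    (f g * q (h^-1 * g)%g * p h)%:E)%E.
  apply: eq_esum => g _; rewrite EFinM convolutionE// -esumZl//.
    by apply: eq_esum => h _; rewrite -EFinM -mulrA (mulrC (q _)).
  by move=> h; rewrite lee_fin mulr_ge0.
rewrite esum_swap; last by move=> g h; rewrite lee_fin !mulr_ge0.
apply: eq_esum => h _.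
rewrite (reindex_esum [set: G] _ (fun k => h * k)%g)//.
  by apply: eq_esum => k _; rewrite mulKg.
split=> //; first by move=> x y _ _ /mulgI.
by move=> g _; exists (h^-1 * g)%g => //; rewrite mulVKg.
Qed.

Lemma convolution_prob p q : probability_on p -> probability_on q ->
  probability_on (convolution p q).
Proof.
move=> pp qp; split; first exact: convolution_ge0.
have := @esum_convolution p q (fun=> 1) pp qp (fun=> ler01).
under eq_esum do rewrite mul1r.
move=> ->; rewrite -{1}pp.2; apply: eq_esum => h _.
under eq_esum do rewrite mul1r mulrC EFinM.
by rewrite esumZl ?pp.1// ?qp.2 ?mule1// => k; rewrite lee_fin qp.1.
Qed.

Lemma ex_convolution p q f : probability_on p -> probability_on q ->
  bounded_fam f ->
  ex (convolution p q) f = ex p (fun g => ex q (fun h => f (g * h)%g)).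
Proof.
move=> pp qp; have cp := convolution_prob pp qp.
have ge0 (f' : G -> R) M : (forall g, 0 <= f' g) -> (forall g, `|f' g| <= M) ->
    ex (convolution p q) f' = ex p (fun g => ex q (fun h => f' (g * h)%g)).
  move=> f0 fM; have bf : bounded_fam f' by exists M.
  have bg g : bounded_fam (fun h => f' (g * h)%g) by exists M.
  apply: EFin_inj; rewrite !exE_ge0//; last 2 first.
  - by move=> g; apply: ex_ge0.
  - by exists M => g; apply: ex_bound.
  rewrite esum_convolution//; apply: eq_esum => g _.
  rewrite EFinM exE_ge0// muleC -esumZl ?pp.1//.
    by apply: eq_esum => k _; rewrite -EFinM mulrC.
  by move=> k; rewrite lee_fin mulr_ge0// qp.1.
move=> [M fM]; have bM := bounded_fam_cst G M.
have := @ge0 (fun g => f g + M) (M + M).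
rewrite exD//; last by exists M.
rewrite (@eq_ex p _ (fun g => ex q (fun h => f (g * h)%g) + M)); last first.
  by move=> g; rewrite exD ?ex_cst//; exists M.
rewrite exD ?ex_cst//; last by exists M => g; apply: ex_bound.
move=> h; apply: (addIr M); apply: h => g.
  by rewrite -lerBlDr sub0r; have := fM g; rewrite ler_norml => /andP[].
rewrite (le_trans (ler_normD _ _))// lerD// ger0_norm//.
exact: le_trans (fM 1%g).
Qed.

Lemma delta1_prob : probability_on (fun g : G => (g == 1%g)%:R : R).
Proof.
split=> [g|]; first by case: eqP.
rewrite -[RHS](@esum_set1 _ _ (1%g : G) (fun=> 1%E)) ?lee_fin//.
rewrite [RHS]esum_mkcond; apply: eq_esum => g _.
by rewrite in_set1; case: eqVneq.
Qed.

End Expectation.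

(** * Masses of points and of finite sets *)

Section MassBounds.
Context {R : realType} {G : groupType}.
Variable p : G -> R.
Hypothesis p_prob : probability_on p.

(** The source of both maximum principles below. It is applied to a deficit [b - u] with [u <= b]:
    if the mean of [u] is close to [b], then [u] is close to [b] at every point of substantial
    mass. *)
Lemma ex_ge_term f x : (forall g, 0 <= f g) -> bounded_fam f ->
  f x * p x <= ex p f.
Proof.
move=> f0 bf; rewrite -{1}(ex_point p_prob x) -exZ//; last first.
  exact: bounded_fam_bool.
apply: ex_le => //.
  apply: bounded_famM; first exact: bounded_fam_cst.
  exact: bounded_fam_bool.
by move=> g; case: eqP => [->|_]; rewrite ?mulr1 ?mulr0.
Qed.

Lemma ex_mem_seq (s : seq G) : uniq s ->
  ex p (fun g => (g \in s)%:R) = \sum_(y <- s) p y.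
Proof.
have b1 (P : pred G) : bounded_fam (fun g => (P g)%:R : R).
  exact: bounded_fam_bool.
elim: s => [_|y s IH /= /andP[ys us]].
  by rewrite big_nil; under eq_ex do rewrite in_nil; exact: ex_cst.
rewrite big_cons -IH// -(ex_point p_prob y) -exD//.
apply: eq_ex => g; rewrite in_cons.
by case: eqP => [->|_]; rewrite ?(negPf ys) ?addr0 ?add0r.
Qed.

Lemma sum_prob_le1 (s : seq G) : uniq s -> \sum_(y <- s) p y <= 1.
Proof.
move=> us; rewrite -ex_mem_seq// -[leRHS](ex_cst p_prob 1).
apply: ex_le => //; last by move=> g; case: (g \in s).
- exact: bounded_fam_bool.
- exact: bounded_fam_cst.
Qed.

Lemma ex_indicU (A B : set G) : ex p \1_(A `|` B) <= ex p \1_A + ex p \1_B.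
Proof.
rewrite -exD//; [|exact: bounded_fam_indic..].
apply: ex_le => //; first exact: bounded_fam_indic.
  by apply: bounded_famD; exact: bounded_fam_indic.
move=> g; rewrite !indicE in_setU.
by case: (g \in A); case: (g \in B); rewrite /= ?addr0 ?add0r// lerDl.
Qed.

Lemma ex_indic_seq (A : set G) (s : seq G) e : (forall g, A g -> g \in s) ->
  (forall g, p g <= e) -> ex p \1_A <= (size s)%:R * e.
Proof.
move=> As pe; have e0 : 0 <= e := le_trans (p_prob.1 1%g) (pe _).
apply: (@le_trans _ _ (ex p (fun g => (g \in undup s)%:R))).
  apply: ex_le => //; first exact: bounded_fam_indic.
    exact: bounded_fam_bool.
  move=> g; rewrite indicE mem_undup; case: (boolP (g \in A)) => //.
  by rewrite inE => /As ->.
rewrite ex_mem_seq ?undup_uniq//.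
apply: (@le_trans _ _ (\sum_(y <- undup s) e)); first exact: ler_sum.
rewrite big_const_seq count_predT iter_addr_0 -[e *+ _]mulr_natl ler_wpM2r//
  ler_nat.
exact: size_undup.
Qed.

End MassBounds.

(** * Convolution powers of a symmetric measure, and their spreading over the group *)

Section ConvolutionPowers.
Context {R : realType} {G : groupType}.
Variable mu : G -> R.
Hypothesis mu_prob : probability_on mu.
Local Notation cp := (convolution_power mu).

Lemma convolution_powerS n : cp n.+1 = convolution (cp n) mu.
Proof. by []. Qed.

Lemma convolution_power_prob n : probability_on (cp n).
Proof.
elim: n => [|n IH]; first exact: delta1_prob.
by rewrite convolution_powerS; exact: convolution_prob.
Qed.
Hint Resolve convolution_power_prob : core.

Lemma ex_convolution_power0 f : bounded_fam f -> ex (cp 0) f = f 1%g.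
Proof.
move=> bf; have b1 : bounded_fam (fun g : G => (g == 1%g)%:R : R).
  exact: bounded_fam_bool.
transitivity (ex (cp 0) (fun g => f 1%g * (g == 1%g)%:R)).
  rewrite !ex.unlock; congr gsum; apply/funext => g /=.
  by case: eqP => [->|_]; rewrite ?mulr1 ?mulr0.
by rewrite exZ// ex_point// /convolution_power/= eqxx mulr1.
Qed.

Lemma ex_convolution_powerS n f : bounded_fam f ->
  ex (cp n.+1) f = ex (cp n) (fun g => ex mu (fun h => f (g * h)%g)).
Proof. by move=> bf; rewrite convolution_powerS ex_convolution. Qed.

Lemma ex_convolution_powerD m n f : bounded_fam f ->
  ex (cp (m + n)) f = ex (cp m) (fun g => ex (cp n) (fun h => f (g * h)%g)).
Proof.
elim: n f => [|n IH] f bf.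
  rewrite addn0; apply: eq_ex => g.
  by rewrite ex_convolution_power0 ?mulg1//; exact: bounded_fam_comp.
rewrite addnS ex_convolution_powerS// IH.
  apply: eq_ex => g; rewrite ex_convolution_powerS.
    by apply: eq_ex => h; apply: eq_ex => k; rewrite mulgA.
  exact: bounded_fam_comp.
have [M fM] := bf; exists M => g; exact: ex_bound.
Qed.

Lemma ex_convolution_power1 f : bounded_fam f -> ex (cp 1) f = ex mu f.
Proof.
move=> bf; rewrite ex_convolution_powerS// ex_convolution_power0.
  by apply: eq_ex => g; rewrite mul1g.
have [M fM] := bf; exists M => g; exact: ex_bound.
Qed.

Lemma ex_symmetric f : symmetric_measure mu -> bounded_fam f ->
  ex mu (fun g => f g^-1%g) = ex mu f.
Proof.
move=> symmu.
have ge0 (f' : G -> R) : (forall g, 0 <= f' g) -> bounded_fam f' ->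
    ex mu (fun g => f' g^-1%g) = ex mu f'.
  move=> f0 bf; apply: EFin_inj; rewrite !exE_ge0//;
    last exact: bounded_fam_comp.
  rewrite (reindex_esum [set: G] _ (fun g => g^-1)%g)//.
    by apply: eq_esum => g _; rewrite invgK -symmu.
  split=> //; first by move=> g h _ _; exact: invg_inj.
  by move=> g _; exists g^-1%g => //; rewrite invgK.
move=> bf; rewrite (ex_posneg mu_prob f) ex_posneg//.
have mx0 (x : R) : 0 <= Num.max x 0 by rewrite le_max lexx orbT.
rewrite (ge0 (fun g => Num.max (f g) 0))//; last exact: bounded_fam_maxr.
rewrite (ge0 (fun g => Num.max (- f g) 0))//.
by apply: bounded_fam_maxr; exact: bounded_famN.
Qed.

(** Inverting a product of steps reverses their order. So the last step is split off on one side and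
    the first step on the other, and the symmetry of [mu] is applied to that single step. *)
Lemma ex_convolution_powerV n f : symmetric_measure mu -> bounded_fam f ->
  ex (cp n) (fun g => f g^-1%g) = ex (cp n) f.
Proof.
move=> symmu; elim: n f => [|n IH] f bf.
  by rewrite !ex_convolution_power0 ?invg1//; exact: bounded_fam_comp.
rewrite ex_convolution_powerS; last exact: bounded_fam_comp.
rewrite ex_swap//; last by have [M fM] := bf; exists M.
rewrite -addn1 addnC ex_convolution_powerD// ex_convolution_power1; last first.
  have [M fM] := bf; exists M => g; exact: ex_bound.
rewrite -[RHS]ex_symmetric//; last first.
  have [M fM] := bf; exists M => g; exact: ex_bound.
apply: eq_ex => h; rewrite -[RHS]IH; last exact: bounded_fam_comp.
by apply: eq_ex => g; rewrite invgM.
Qed.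

Lemma convolution_powerD_point m n x :
  cp (m + n) x = ex (cp m) (fun s => cp n (s^-1 * x)%g).
Proof.
have b1 : bounded_fam (fun g : G => (g == x)%:R : R).
  exact: bounded_fam_bool.
rewrite -(ex_point _ x)// ex_convolution_powerD//; apply: eq_ex => s.
rewrite -(ex_point _ (s^-1 * x)%g)//; apply: eq_ex => h.
by congr (_%:R); congr nat_of_bool; apply/eqP/eqP => [<-|->];
  rewrite ?mulKg ?mulVKg.
Qed.

Lemma convolution_powerS_gt0 n g h : cp n g != 0 -> mu h != 0 ->
  cp n.+1 (g * h)%g != 0.
Proof.
move=> ng0 mh0; rewrite -addn1 convolution_powerD_point.
have c10 : cp 1 h = mu h.
  rewrite -(ex_point _ h)// ex_convolution_power1 ?ex_point//.
  exact: bounded_fam_bool.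
have := @ex_ge_term _ _ (cp n) (convolution_power_prob n)
  (fun s => cp 1 (s^-1 * (g * h))%g) g.
rewrite mulKg c10 => le; rewrite gt_eqF// (lt_le_trans _ (le _ _))//.
- by rewrite mulr_gt0// lt0r ?mh0 ?ng0 ?mu_prob.1 ?(convolution_power_prob n).1.
- by move=> k; exact: (convolution_power_prob 1).1.
- exists 1 => k; rewrite ger0_norm ?prob_le1//.
  exact: (convolution_power_prob 1).1.
Qed.

Lemma support_nonempty : exists s, mu s != 0.
Proof.
apply: contrapT => /forallNP mu0; have := mu_prob.2.
rewrite esum1 => [/eqP|g _]; first by rewrite eq_sym onee_eq0.
by have /negP := mu0 g; rewrite negbK => /eqP ->.
Qed.

(** A step [s] of the support can be undone by the step [s^-1]. Supports therefore increase along
    times of equal parity, whereas the walk may be periodic and supports at consecutive times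
    disjoint. *)
Lemma convolution_powerSS_gt0 n g : symmetric_measure mu -> cp n g != 0 ->
  cp n.+2 g != 0.
Proof.
move=> symmu ng0; have [s s0] := support_nonempty.
rewrite -[g](mulgK s); apply: convolution_powerS_gt0; last by rewrite -symmu.
exact: convolution_powerS_gt0.
Qed.

Lemma generated_semigroup_convolution_power g :
  generated_semigroup (support_of mu) g -> exists n, cp n g != 0.
Proof.
move=> Gg.
(* Quantifying over the starting point [x] makes the property stable under products, as minimality
   of the generated semigroup requires. *)
suff /(_ 1%g) : forall x, (exists n, cp n x != 0) ->
    exists n, cp n (x * g)%g != 0.
  rewrite mul1g; apply; exists 0%N.
  by rewrite /convolution_power/= eqxx oner_neq0.
apply: (Gg [set g | forall x, (exists n, cp n x != 0) ->
  exists n, cp n (x * g)%g != 0]); split.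
  by move=> h k /= Hh Hk x /Hh /Hk; rewrite mulgA.
by move=> h /= mh x [n nx]; exists n.+1; exact: convolution_powerS_gt0.
Qed.

Hypothesis mu_sym : symmetric_measure mu.
Hypothesis mu_infinite : ~ finite_set (generated_semigroup (support_of mu)).

(** An element reached at an odd time is reached at an even time after one more step [s]. So the
    group is covered by the even support and one right translate of it. *)
Lemma infinite_even_support : ~ finite_set [set g | exists n, cp n.*2 g != 0].
Proof.
move=> finE; apply: mu_infinite; have [s s0] := support_nonempty.
apply: sub_finite_set (_ : finite_set ([set g | exists n, cp n.*2 g != 0] `|`
  [set (g * s^-1)%g | g in [set g | exists n, cp n.*2 g != 0]])); last first.
  by rewrite finite_setU; split=> //; exact: finite_image.
move=> g /generated_semigroup_convolution_power[n ng].
have [on|en] := boolP (odd n).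
  right; exists (g * s)%g; last by rewrite mulgK.
  exists (n.+1)./2; rewrite [(_./2).*2]even_halfK ?on//=; last by rewrite on.
  exact: convolution_powerS_gt0.
by left; exists n./2; rewrite even_halfK.
Qed.

Lemma convolution_power_even_mono m n g : (m <= n)%N ->
  cp m.*2 g != 0 -> cp n.*2 g != 0.
Proof.
move=> /subnK <-; elim: (n - m)%N => // k IH mg.
by rewrite addSn doubleS convolution_powerSS_gt0// IH.
Qed.

(** Even supports increase, so finitely many elements of their infinite union are charged at one
    common time. *)
Lemma large_support N : exists n, exists s : seq G,
  [/\ uniq s, (N <= size s)%N & forall g, g \in s -> cp n g != 0].
Proof.
have [B BE Bs] := infinite_set_fset N infinite_even_support.
have [n nP] : exists n, forall g, g \in (B : seq G) -> cp n.*2 g != 0.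
  have {BE} : forall g, g \in (B : seq G) -> exists n, cp n.*2 g != 0.
    by move=> g gB; apply: BE.
  elim: (B : seq G) => [_|y s IH sP]; first by exists 0%N.
  have [n nP] := IH (fun g gs => sP g (mem_behead (s := y :: s) gs)).
  have [m mP] := sP y (mem_head _ _).
  exists (maxn m n) => g; rewrite in_cons => /predU1P[->|/nP].
    exact/(convolution_power_even_mono _ mP)/leq_maxl.
  exact/convolution_power_even_mono/leq_maxr.
by exists n.*2, B; split=> //; exact: fset_uniq.
Qed.

(** Each value of [cp (m + n)] is a mean of values of [cp n], so the supremum over the group never
    grows with time. *)
Lemma convolution_power_bound_mono m n b : (forall x, cp n x <= b) ->
  forall x, cp (m + n) x <= b.
Proof.
move=> nb x; rewrite convolution_powerD_point.
apply: le_trans (ler_norm _) (ex_bound _ _) => // g.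
by rewrite ger0_norm// (convolution_power_prob n).1.
Qed.

(* Maximum principle: if the suprema of the [cp n] decrease to [m > 0], then for
   large [n] and a near-maximizing [x], [cp n (s^-1 * x)] exceeds [m / 2] for
   more than [2 / m] elements [s], and the total mass exceeds [1]. *)
Theorem convolution_power_vanish (e : R) : 0 < e ->
  exists N, forall n, (N <= n)%N -> forall x, cp n x <= e.
Proof.
move=> e0; pose B := [set b : R | exists n, forall x, cp n x <= b].
have B1 : B 1 by exists 0%N => x; exact: prob_le1.
have B0 b : B b -> 0 <= b.
  by move=> [n /(_ 1%g)]; apply: le_trans; exact: (convolution_power_prob n).1.
have hB : has_inf B by split; [exists 1|exists 0 => b /B0].
set m := inf B.
have mB b : B b -> m <= b by move=> Bb; apply: ge_inf => //; exact: hB.2.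
have m0 : 0 <= m by apply: lb_le_inf; [exists 1|move=> b /B0].
have [m_gt0|m_le0] := ltP 0 m; last first.
  have [b [N Nb] bm] := inf_adherent e0 hB.
  exists N => n /subnK <- x; apply: le_trans (convolution_power_bound_mono _ Nb
    x) _.
  by rewrite ltW// (lt_le_trans bm)// -/m; lra.
exfalso.
have [K [s [us Ns sP]]] := large_support (Num.truncn (2 / m)).+1.
have [c c0 cP] : exists2 c, 0 < c & forall g, g \in s -> c <= cp K g.
  elim: s sP {us Ns} => [_|y s IH sP]; first by exists 1.
  have [c c0 cP] := IH (fun g gs => sP g (mem_behead (s := y :: s) gs)).
  exists (Num.min c (cp K y)).
    by rewrite lt_min c0 lt0r sP ?mem_head// (convolution_power_prob K).1.
  by move=> g; rewrite in_cons => /predU1P[->|/cP];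
    rewrite ge_min ?lexx ?orbT// => ->.
(* With this tolerance, [b < m + c * m / 4] and [cp (K + n) x > m - c * m / 4], so the mean deficit
   [b - cp n (s^-1 * x)] under [cp K] is below [c * m / 2]. Every [y] in [s] has mass at least [c],
   so its own deficit is at most [m / 2]. *)
have cm0 : 0 < c * m / 4 by rewrite divr_gt0// mulr_gt0.
have [b [n nb] bm] := inf_adherent cm0 hB; rewrite -/m in bm.
have [x xP] : exists x, m - c * m / 4 < cp (K + n) x.
  apply: contrapT => /forallNP H; have : B (m - c * m / 4).
    by exists (K + n)%N => x; rewrite leNgt; apply/negP.
  by move=> /mB; lra.
have mb : m <= b by apply: mB; exists n.
have half y : y \in s -> m / 2 <= cp n (y^-1 * x)%g.
  move=> ys; have := xP; rewrite convolution_powerD_point => lt.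
  have bf : bounded_fam (fun s => cp n (s^-1 * x)%g).
    by exists b => g; rewrite ger0_norm// (convolution_power_prob n).1.
  have := @ex_ge_term _ _ (cp K) (convolution_power_prob K)
    (fun s => b - cp n (s^-1 * x)%g) y.
  rewrite exB//; last exact: bounded_fam_cst.
  rewrite ex_cst// => /(_ _ _)/wrap[]; first by move=> g; rewrite subr_ge0.
    by apply: bounded_famB => //; exact: bounded_fam_cst.
  have F0 : 0 <= b - cp n (y^-1 * x)%g by rewrite subr_ge0.
  have := ler_wpM2l F0 (cP y ys).
  nra.
have : \sum_(y <- map (fun y => y^-1 * x)%g s) cp n y <= 1.
  apply: sum_prob_le1 => //; rewrite map_inj_uniq// => y z /mulIg.
  exact: invg_inj.
apply/negP; rewrite -ltNge big_map.
apply: (@lt_le_trans _ _ (\sum_(y <- s) m / 2)).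
  rewrite big_const_seq count_predT iter_addr_0 -[_ *+ _]mulr_natl.
  rewrite -ltr_pdivrMr ?divr_gt0// mul1r invf_div.
  apply: lt_le_trans (_ : ((Num.truncn (2 / m)).+1)%:R <= _);
    last by rewrite ler_nat.
  exact: truncnS_gt.
by rewrite big_seq [leRHS]big_seq; apply: ler_sum.
Qed.

End ConvolutionPowers.

(** * Gromov products and boundary points, up to multiples of [delta] *)

Section GromovProduct.
Context {R : realType} {X : metricType R}.
Implicit Types (w x y z : X).
Local Notation gp := gromov_product.

Lemma gromov_productC w x y : gp w x y = gp w y x.
Proof. by rewrite /gp (addrC (mdist x w)) (metric_sym x y). Qed.

Lemma gromov_product_le w x y : gp w x y <= mdist x w.
Proof.
rewrite /gp; have := metric_triangle y x w; rewrite (metric_sym y x).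
lra.
Qed.

Lemma gromov_product_sum o w x : gp w o x + gp o w x = mdist o w.
Proof.
rewrite /gp (metric_sym w o) (metric_sym x w) (metric_sym x o).
by rewrite (metric_sym w x); lra.
Qed.

Lemma gromov_equivP o (x y : nat -> X) : gromov_equiv o x y <->
  forall A, exists N, forall n m, (N <= n)%N -> (N <= m)%N -> A <= gp o (x n) (y
    m).
Proof.
split=> [/cvgryPge xy A|xy].
  have [[P Q] [/= [N _ NP] [M _ MQ]] PQ] := xy A.
  exists (maxn N M) => n m; rewrite !geq_max => /andP[Nn _] /andP[_ Mm].
  by apply: (PQ (n, m)); split=> /=; [exact: NP|exact: MQ].
apply/cvgryPge => A; have [N NA] := xy A.
exists ([set n | (N <= n)%N], [set n | (N <= n)%N]).
  by split; exists N.
by move=> [n m] [] /=; exact: NA.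
Qed.

End GromovProduct.

Section Hyperbolic.
Context {R : realType} {X : metricType R}.
Variable delta : R.
Hypothesis delta_ge0 : 0 <= delta.
Local Notation gp := gromov_product.
Hypothesis hyp : forall x y z w : X,
  Num.min (gp w x z) (gp w z y) - delta <= gp w x y.

Lemma hyperbolic_le (w x y z : X) r : r <= gp w x z -> r <= gp w z y ->
  r - delta <= gp w x y.
Proof.
by move=> xz zy; apply: le_trans (hyp x y z w); rewrite lerD2r le_min xz.
Qed.

Section Boundary.
Variable o : X.
Implicit Types (xi eta zeta : boundary o).

Lemma gromov_equiv_sym (x y : nat -> X) : gromov_equiv o x y -> gromov_equiv o y
  x.
Proof.
move=> /gromov_equivP xy; apply/gromov_equivP => A; have [N NA] := xy A.
by exists N => n m Nn Nm; rewrite gromov_productC; exact: NA.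
Qed.

Lemma gromov_equiv_trans (x y z : nat -> X) :
  gromov_equiv o x y -> gromov_equiv o y z -> gromov_equiv o x z.
Proof.
move=> /gromov_equivP xy /gromov_equivP yz; apply/gromov_equivP => A.
have [N NA] := xy (A + delta); have [M MA] := yz (A + delta).
exists (maxn N M) => n m; rewrite !geq_max => /andP[Nn Mn] /andP[Nm Mm].
rewrite -[A](addrK delta); apply: (@hyperbolic_le _ _ _ (y (maxn N M))).
  by apply: NA => //; exact: leq_maxl.
by apply: MA => //; exact: leq_maxr.
Qed.

Lemma bclass_nonempty xi : exists x, bclass xi x.
Proof. by have [x gx ->] := bclassP xi; exists x. Qed.

Lemma bclass_seq xi x : bclass xi x -> gromov_seq o x.
Proof. by have [y _ ->] := bclassP xi => -[]. Qed.

Lemma bclass_equiv xi x y : bclass xi x -> bclass xi y -> gromov_equiv o x y.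
Proof.
have [z _ ->] := bclassP xi => -[_ zx] [_ zy].
exact: gromov_equiv_trans (gromov_equiv_sym zx) zy.
Qed.

Lemma bclass_eq xi eta x y : bclass xi x -> bclass eta y ->
  gromov_equiv o x y -> xi = eta.
Proof.
move=> xix etay xy.
have E : bclass xi = bclass eta.
  move: xix etay; have [a _ ->] := bclassP xi; have [b _ ->] := bclassP eta.
  move=> [_ ax] [_ byy]; apply/seteqP; split=> z [gz] zz; split=> //.
    apply: gromov_equiv_trans zz; apply: gromov_equiv_trans (gromov_equiv_sym
      ax).
    exact: gromov_equiv_trans byy (gromov_equiv_sym xy).
  apply: gromov_equiv_trans zz; apply: gromov_equiv_trans (gromov_equiv_sym
    byy).
  exact: gromov_equiv_trans ax xy.
move: xi eta E {xix etay} => [c cP] [c' c'P] /= E.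
by case: _ / E c'P => c'P; congr Boundary; exact: Prop_irrelevance.
Qed.

(* [bnear r xi eta] and [pnear r p xi] are working versions of
   [(xi | eta)_o >= r] and [(p | xi)_o >= r], valid up to a multiple of
   [delta]; they are required for all representatives. *)
Definition bnear (r : R) xi eta : Prop :=
  forall x y, bclass xi x -> bclass eta y ->
  exists N, forall n m, (N <= n)%N -> (N <= m)%N -> r <= gp o (x n) (y m).

Definition pnear (r : R) (p : X) xi : Prop :=
  forall x, bclass xi x -> exists N, forall n, (N <= n)%N -> r <= gp o p (x n).

Lemma bnear_weaken r s xi eta : s <= r -> bnear r xi eta -> bnear s xi eta.
Proof.
move=> sr xe x y xix etay; have [N NP] := xe x y xix etay.
by exists N => n m Nn Nm; rewrite (le_trans sr)// NP.
Qed.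

Lemma pnear_weaken r s p xi : s <= r -> pnear r p xi -> pnear s p xi.
Proof.
move=> sr px x xix; have [N NP] := px x xix.
by exists N => n Nn; rewrite (le_trans sr)// NP.
Qed.

Lemma bnear_refl r xi : bnear r xi xi.
Proof. by move=> x y xix xiy; have /gromov_equivP := bclass_equiv xix xiy;
  apply. Qed.

Lemma bnear_trans r xi eta zeta : bnear r xi eta -> bnear r eta zeta ->
  bnear (r - delta) xi zeta.
Proof.
move=> xe ez x z xix zz; have [y etay] := bclass_nonempty eta.
have [N NP] := xe x y xix etay; have [M MP] := ez y z etay zz.
exists (maxn N M) => n m; rewrite !geq_max => /andP[Nn Mn] /andP[Nm Mm].
apply: (@hyperbolic_le _ _ _ (y (maxn N M))).
  by apply: NP => //; exact: leq_maxl.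
by apply: MP => //; exact: leq_maxr.
Qed.

Lemma bnear_eq xi eta : (forall r, bnear r xi eta) -> xi = eta.
Proof.
move=> xe; have [x xix] := bclass_nonempty xi;
  have [y etay] := bclass_nonempty eta.
by apply: (bclass_eq xix etay); apply/gromov_equivP => A; exact: xe.
Qed.

(** Two representatives of one boundary point have arbitrarily large mutual products. Replacing [x]
    and [y] one after the other therefore costs one [delta] each. *)
Lemma bnear_rep r xi eta x y : bclass xi x -> bclass eta y ->
  (exists N, forall n m, (N <= n)%N -> (N <= m)%N -> r <= gp o (x n) (y m)) ->
  bnear (r - 2 * delta) xi eta.
Proof.
move=> xix etay [N NP] x' y' xix' etay'.
have /gromov_equivP/(_ r)[M MP] := bclass_equiv xix' xix.
have /gromov_equivP/(_ r)[L LP] := bclass_equiv etay etay'.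
pose K := maxn N (maxn M L); have NK : (N <= K)%N by rewrite leq_max leqnn.
have MK : (M <= K)%N by rewrite !leq_max leqnn orbT.
have LK : (L <= K)%N by rewrite !leq_max leqnn !orbT.
exists K => n m Kn Km.
have h1 : r - delta <= gp o (x K) (y' m).
  apply: (@hyperbolic_le _ _ _ (y K)); first exact: NP.
  by apply: LP => //; exact: leq_trans Km.
have := @hyperbolic_le o (x' n) (y' m) (x K) (r - delta) _ h1.
rewrite -addrA -opprD -mulr2n -[delta *+ 2]mulr_natl; apply.
apply: (@le_trans _ _ r); first by rewrite gerBl.
by apply: MP => //; exact: leq_trans Kn.
Qed.

Lemma pnear_rep r p xi x : bclass xi x ->
  (exists N, forall n, (N <= n)%N -> r <= gp o p (x n)) -> pnear (r - delta) p
    xi.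
Proof.
move=> xix [N NP] x' xix'.
have /gromov_equivP/(_ r)[M MP] := bclass_equiv xix xix'.
exists (maxn N M) => n; rewrite geq_max => /andP[Nn Mn].
apply: (@hyperbolic_le _ _ _ (x (maxn N M))); first by apply: NP;
  exact: leq_maxl.
by apply: MP => //; exact: leq_maxr.
Qed.

Lemma pnear_bnear r p xi eta : pnear r p xi -> pnear r p eta ->
  bnear (r - delta) xi eta.
Proof.
move=> pxi peta x y xix etay; have [N NP] := pxi x xix.
have [M MP] := peta y etay; exists (maxn N M) => n m.
rewrite !geq_max => /andP[Nn Mn] /andP[Nm Mm].
apply: (@hyperbolic_le _ _ _ p); last exact: MP.
by rewrite gromov_productC NP.
Qed.

(** A failure of [pnear] only gives small products infinitely often along one representative. If the
    products with another representative exceeded [r + delta] infinitely often, a single such term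
    would force products at least [r] with the whole tail of every representative. *)
Lemma pnear_not r p xi : ~ pnear r p xi ->
  forall x, bclass xi x ->
  exists N, forall n, (N <= n)%N -> gp o p (x n) <= r + delta.
Proof.
move=> npr x xix; apply: contrapT => H; apply: npr => x' xix'.
have /gromov_equivP/(_ (r + delta))[M MP] := bclass_equiv xix xix'.
exists M => n Mn; rewrite leNgt; apply/negP => lt; apply: H.
exists M => m Mm; rewrite leNgt; apply/negP => gt.
have := @hyperbolic_le o p (x' n) (x m) (r + delta) (ltW gt) (MP _ _ Mm Mn).
lra.
Qed.

End Boundary.
End Hyperbolic.

(** * The topology of the boundary in terms of [bnear] *)

Section BoundaryTopology.
Context {R : realType} {X : metricType R}.
Variable delta : R.
Hypothesis delta_ge0 : 0 <= delta.
Local Notation gp := gromov_product.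
Hypothesis hyp : forall x y z w : X,
  Num.min (gp w x z) (gp w z y) - delta <= gp w x y.
Variable o : X.
Implicit Types (xi eta zeta : boundary o).

(** The extended product is a supremum over representatives, while [bnear] asks for all of them.
    With its converse below, this shows that the two agree up to [2 * delta] and define the same
    neighbourhoods. *)
Lemma boundary_product_bnear r xi eta :
  (r%:E < boundary_product xi eta)%E -> bnear (r - 2 * delta) xi eta.
Proof.
move=> /ereal_sup_gt[_ [x [y [xix etay ->]]]].
rewrite limf_einfE => /ereal_sup_gt[_ [V [[P Q] [/= [N _ NP] [M _ MQ]] PQ] <-]]
  rV.
apply: (bnear_rep delta_ge0 hyp xix etay); exists (maxn N M) => n m.
rewrite !geq_max => /andP[Nn _] /andP[_ Mm]; rewrite -lee_fin.
apply: le_trans (ltW rV) _; apply: ereal_inf_lbound; exists (n, m) => //.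
by apply: PQ; split=> /=; [exact: NP|exact: MQ].
Qed.

Lemma bnear_boundary_product r xi eta :
  bnear r xi eta -> (r%:E <= boundary_product xi eta)%E.
Proof.
move=> xe; have [x xix] := bclass_nonempty xi;
  have [y etay] := bclass_nonempty eta.
have [N NP] := xe x y xix etay.
apply: le_trans (_ : limf_einf (fun p : nat * nat => (gp o (x p.1) (y p.2))%:E)
    (filter_prod \oo \oo) <= _)%E; last first.
  by apply: ereal_sup_ubound; exists x, y.
rewrite limf_einfE; apply: le_trans (_ : ereal_inf [set (gp o (x p.1) (y
  p.2))%:E |
  p in [set p : nat * nat | (N <= p.1)%N /\ (N <= p.2)%N]] <= _)%E.
  by apply: le_ereal_inf_tmp => _ [[n m] /= [Nn Nm] <-]; rewrite lee_fin NP.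
apply: ereal_sup_ubound; exists [set p : nat * nat | (N <= p.1)%N /\ (N <=
  p.2)%N] => //.
exists ([set n | (N <= n)%N], [set n | (N <= n)%N]).
  by split; exists N.
by move=> [n m] [].
Qed.

Lemma boundary_openE (U : set (boundary o)) : open U <->
  forall xi, U xi -> exists r, forall eta, bnear r xi eta -> U eta.
Proof.
rewrite -[open U]/(boundary_open U); split=> oU xi Uxi.
  have [r rU] := oU _ Uxi; exists (r + 1) => eta /bnear_boundary_product re.
  by apply: rU; apply: lt_le_trans re; rewrite lte_fin ltrDl.
have [r rU] := oU _ Uxi; exists (r + 2 * delta) => eta /=
  /boundary_product_bnear.
by rewrite addrK; exact: rU.
Qed.

(** The interior of the set of [eta] with [bnear r xi eta]. That set need not be open, and openness
    is what gives Borel measurability. *)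
Definition bball (r : R) xi : set (boundary o) :=
  [set eta | exists s, forall eta', bnear s eta eta' -> bnear r xi eta'].

Lemma bball_open r xi : open (bball r xi).
Proof.
apply/boundary_openE => eta [s sP]; exists (s + delta) => eta' ee.
exists (s + delta) => eta'' ee'; apply: sP.
by have := bnear_trans hyp ee ee'; rewrite addrK.
Qed.

Lemma bball_bnear r xi eta : bball r xi eta -> bnear r xi eta.
Proof. by move=> [s]; apply; exact: bnear_refl. Qed.

Lemma bnear_bball r xi eta : bnear (r + delta) xi eta -> bball r xi eta.
Proof.
move=> xe; exists (r + delta) => eta' ee.
by have := bnear_trans hyp xe ee; rewrite addrK.
Qed.

Lemma bball_center r xi : bball r xi xi.
Proof. by apply: bnear_bball; exact: bnear_refl. Qed.

Lemma nbhs_bnear xi (A : set (boundary o)) : nbhs xi A ->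
  exists r, forall eta, bnear r xi eta -> A eta.
Proof.
move=> [U [oU Uxi UA]]; have [r rU] := (boundary_openE U).1 oU _ Uxi.
by exists r => eta /rU; exact: UA.
Qed.

Lemma continuous_bnear (phi : boundary o -> R) xi e : continuous phi -> 0 < e ->
  exists r, forall eta, bnear r xi eta -> `|phi xi - phi eta| < e.
Proof.
move=> cphi e0; apply: (@nbhs_bnear xi [set eta | `|phi xi - phi eta| < e]).
by have /cvgrPdist_lt/(_ _ e0) := cphi xi.
Qed.

End BoundaryTopology.

(** * Sequential compactness of the boundary *)

Section Compactness.
Context {R : realType} {X : metricType R}.
Variable delta : R.
Hypothesis delta_ge0 : 0 <= delta.
Local Notation gp := gromov_product.
Hypothesis hyp : forall x y z w : X,
  Num.min (gp w x z) (gp w z y) - delta <= gp w x y.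
Hypothesis X_proper : proper_space X.
Variable o : X.
Implicit Types (xi eta zeta : boundary o).

Variable C : R.
Hypothesis rough : forall x y : X, exists (T : R) (p : R -> X),
    [/\ 0 <= T, p 0 = x, p T = y &
      forall t t' : R, t \in `[0, T] -> t' \in `[0, T] ->
        `|t - t'| - C <= mdist (p t) (p t') <= `|t - t'| + C].

Lemma rough_ge0 : 0 <= C.
Proof.
have [T [p [T0 p0 _ /(_ 0 0)]]] := rough o o.
by rewrite in_itv/= lexx T0 subrr normr0 mdistxx !add0r => /(_ isT isT)/andP[].
Qed.

Lemma rough_point (x : X) (N : R) : 0 <= N -> N + C <= mdist o x ->
  exists2 y, mdist o y <= N + C & N - 2 * C <= gp o y x.
Proof.
move=> N0 Nx; have C0 := rough_ge0; have [T [p [T0 p0 pT pP]]] := rough o x.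
have T0' : 0 \in `[0, T] by rewrite in_itv/= lexx T0.
have TT : T \in `[0, T] by rewrite in_itv/= lexx T0.
have /andP[h1 h2] := pP _ _ T0' TT.
rewrite p0 pT sub0r normrN ger0_norm// in h1 h2.
have NT : N \in `[0, T] by rewrite in_itv/= N0/=; lra.
have /andP[h3 h4] := pP _ _ T0' NT; have /andP[h5 h6] := pP _ _ NT TT.
rewrite p0 sub0r normrN ger0_norm// in h3 h4.
rewrite pT distrC ger0_norm ?subr_ge0 in h5 h6; last by lra.
exists (p N) => //; rewrite /gp (metric_sym _ o) (metric_sym x o); lra.
Qed.

Lemma boundary_point_near xi (N : R) : 0 <= N ->
  exists2 y, mdist o y <= N + C & pnear (N - 2 * C - 2 * delta) y xi.
Proof.
move=> N0; have C0 := rough_ge0; have [x xix] := bclass_nonempty xi.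
have /gromov_equivP/(_ (N + C))[k kP] := bclass_seq xix.
have Nx : N + C <= mdist o (x k).
  rewrite metric_sym; apply: le_trans (gromov_product_le _ _ (x k)).
  exact: kP.
have [y yN yx] := rough_point N0 Nx.
(* One [delta] passes from the single point [x k] to the tail of the sequence, the other to all
   representatives of [xi]. *)
exists y => //; have -> : N - 2 * C - 2 * delta = N - 2 * C - delta - delta by
  lra.
apply: (pnear_rep hyp xix); exists k => n kn.
apply: (hyperbolic_le hyp yx); apply: le_trans (kP k n _ kn) => //; lra.
Qed.

Lemma gromov_product_lip (w x y x' y' : X) :
  gp w x y - mdist x x' - mdist y y' <= gp w x' y'.
Proof.
rewrite /gp; have := metric_triangle x x' w; have := metric_triangle y y' w.
have := metric_triangle x' x y'; have := metric_triangle x y y'.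
have := metric_triangle x' x y'; rewrite (metric_sym x' x); lra.
Qed.

(** For each scale [N], the point [y (N, n)] at distance about [N] on a rough ray to [xi_ n] stays
    in a compact ball. One ultrafilter on the indices [n] gives limits [z N] at all scales at once,
    in place of a diagonal extraction, and the sequence [z] represents the cluster point. *)
Theorem boundary_sequence_compact (xi_ : nat -> boundary o) :
  exists zeta, forall r N, exists2 n, (N <= n)%N & bnear r zeta (xi_ n).
Proof.
(* In [c], the part [2 * C + 2 * delta] comes from the choice of the points [y], the next [delta]
   from comparing two scales through a common [xi_ n], and [2] from moving both points by less than
   [1] to their limits. *)
have C0 := rough_ge0; have [c cE] : exists c, c = 2 * C + 2 * delta + delta + 2
  by eexists.
have /choice[y yP] : forall p : nat * nat, exists y,
    mdist o y <= p.1%:R + C /\ pnear (p.1%:R - 2 * C - 2 * delta) y (xi_ p.2).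
  move=> p; have [y y1 y2] := @boundary_point_near (xi_ p.2) p.1%:R (ler0n _ _).
  by exists y.
have [U [UU ooU]] := @ultraFilterLemma nat \oo _.
have /choice[z zP] : forall N, exists z, U [set n | mdist z (y (N, n)) < 1].
  move=> N.
  have Uy : ((fun n => y (N, n)) @ U) [set x | mdist o x <= N%:R + C].
    suff : U [set n | mdist o (y (N, n)) <= N%:R + C] by [].
    by apply: (filterS (P := setT)) filterT => n _ /=; have [] := yP (N, n).
  have [z [_ zc]] := X_proper (fmap_proper_filter _ (@ultra_proper _ _ UU)) Uy.
  exists z; have [//|nU] := in_ultra_setVsetC [set n | mdist z (y (N, n)) < 1]
    UU.
  have nU' : ((fun n => y (N, n)) @ U) ((fun n => y (N, n)) @` ~` [set n | mdist
    z (y (N, n)) < 1]).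
    suff : U ((fun n => y (N, n)) @^-1` ((fun n => y (N, n)) @`
        ~` [set n | mdist z (y (N, n)) < 1])) by [].
    by apply: filterS nU => n; exists n.
  have [x [/= [n nn <-] yn]] := zc _ _ nU' (nbhsx_ballx z 1 ltr01).
  by exfalso; move: yn; rewrite ballEmdist; exact: nn.
have zz N M : Num.min N%:R M%:R - c <= gp o (z N) (z M).
  have [n [n1 n2]] := filter_ex (filterI (zP N) (zP M)).
  have [_ p1] := yP (N, n); have [_ p2] := yP (M, n).
  rewrite /= in p1 p2 n1 n2.
  have [x xx] := bclass_nonempty (xi_ n).
  have [k1 k1P] := p1 x xx; have [k2 k2P] := p2 x xx.
  have h : Num.min N%:R M%:R - 2 * C - 2 * delta - delta <=
      gp o (y (N, n)) (y (M, n)).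
    apply: (@hyperbolic_le _ _ _ hyp _ _ _ (x (maxn k1 k2))).
      apply: le_trans (k1P _ (leq_maxl _ _)).
      by rewrite !lerD2r ge_min lexx.
    rewrite gromov_productC; apply: le_trans (k2P _ (leq_maxr _ _)).
    by rewrite !lerD2r ge_min lexx orbT.
  have := gromov_product_lip o (y (N, n)) (y (M, n)) (z N) (z M).
  rewrite (metric_sym _ (z N)) (metric_sym _ (z M)) cE; lra.
have gz : gromov_seq o z.
  apply/gromov_equivP => A; exists (Num.truncn (A + c)).+1 => n m An Am.
  apply: le_trans (zz n m); rewrite lerBrDr le_min.
  have lt k : ((Num.truncn (A + c)).+1 <= k)%N -> A + c <= k%:R.
    by rewrite -(ler_nat R); apply: le_trans; exact/ltW/truncnS_gt.
  by rewrite !lt.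
pose zeta := Boundary (ex_intro2 _ _ z gz erefl).
have zzeta : bclass zeta z by split.
(* The scale [L] exceeds [r + c] by [1] for moving [z L] to [y (L, n)], by one [delta] for the
   change of representative of [zeta], and by one for joining [zeta] to [xi_ n] through
   [y (L, n)]. *)
exists zeta => r N; have [L Lr] : exists L, r + c + delta + delta + 1 < L%:R.
  by eexists; exact: truncnS_gt.
have [n [n1 n2]] := filter_ex (filterI (zP L) (ooU _ (nbhs_infty_ge N))).
exists n => //; have [_ p] := yP (L, n); rewrite /= in p n1.
have pz : pnear (r + delta) (y (L, n)) zeta.
  rewrite -[r + delta](addrK delta); apply: (pnear_rep hyp zzeta).
  exists L => m Lm.
  have := gromov_product_lip o (z L) (z m) (y (L, n)) (z m).
  rewrite mdistxx subr0; apply: le_trans.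
  have := zz L m; rewrite min_l ?ler_nat//; lra.
rewrite -[r](addrK delta); apply: (pnear_bnear hyp pz).
move=> x xx; have [k kP] := p x xx; exists k => m km.
by apply: le_trans (kP m km); rewrite cE in Lr; have := delta_ge0; lra.
Qed.

End Compactness.

Lemma ultra_lim {R : realType} (T : Type) (U : set_system T) (f : T -> R) M :
  UltraFilter U -> (forall t, `|f t| <= M) ->
  exists l, forall e, 0 < e -> U [set t | `|f t - l| < e].
Proof.
move=> UU fM; have Uf : (f @ U) `[- M, M]%classic.
  suff : U [set t | f t \in `[- M, M]] by [].
  apply: (filterS (P := setT)) filterT => t _ /=.
  by rewrite in_itv/= -ler_norml.
have [l [_ lc]] := @segment_compact R (- M) M _ (fmap_proper_filter _
  (@ultra_proper _ _ UU)) Uf.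
exists l => e e0; have [//|nU] := in_ultra_setVsetC [set t | `|f t - l| < e] UU.
have nU' : (f @ U) (f @` ~` [set t | `|f t - l| < e]).
  suff : U (f @^-1` (f @` ~` [set t | `|f t - l| < e])) by [].
  by apply: filterS nU => t; exists t.
have [x [/= [t nt <-] lt]] := lc _ _ nU' (nbhsx_ballx l e e0).
by exfalso; apply: nt => /=; rewrite distrC.
Qed.

(** * Heights relative to a boundary point *)

Section Horofunction.
Context {R : realType} {X : metricType R}.
Variable delta : R.
Hypothesis delta_ge0 : 0 <= delta.
Local Notation gp := gromov_product.
Hypothesis hyp : forall x y z w : X,
  Num.min (gp w x z) (gp w z y) - delta <= gp w x y.
Variable o : X.

(** The four-point inequality bounds the left side by the larger of [d(y,z) + d(x,z')] and
    [d(x,y) + d(z,z')], up to [2 * delta]. The hypothesis places [z] and [z'] so close at infinity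
    that the second sum is too small. *)
Lemma busemann_le (x y z z' : X) :
  mdist x o + mdist y o + delta < gp o z z' ->
  mdist x z + mdist y z' <= mdist y z + mdist x z' + 2 * delta.
Proof.
move=> zz; have := hyp x z z' y; rewrite /gp.
have := metric_triangle z x o; have := metric_triangle z' y o.
have := metric_triangle x o y; rewrite (metric_sym o y).
move: zz; rewrite /gp (metric_sym z x) (metric_sym z' y) (metric_sym z y)
  (metric_sym z' z).
case: (lerP ((mdist x y + mdist y z' - mdist x z') / 2)
            ((mdist y z' + mdist y z - mdist z z') / 2)) => h; lra.
Qed.

(* The [mheight] of two points is the height at which the rough rays from these
   points to [zeta] merge; hyperbolicity seen from [zeta] makes it an
   ultrametric up to [delta]. *)
Definition mheight (l : X -> R) (x y : X) : R := (mdist x y + l x + l y) / 2.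

Lemma mheightC l x y : mheight l x y = mheight l y x.
Proof. by rewrite /mheight metric_sym addrAC. Qed.

(** Here [l x] is the limit of [d(o,z_k) - d(x,z_k)] along an ultrafilter: minus a Busemann
    function, growing towards the boundary point of [z]. Accordingly [mheight l x y] is the limit of
    [d(o,z_k) - (x|y)_(z_k)], so the second property is hyperbolicity based at [z_k]. The third says
    that an element fixing the boundary point shifts heights by a constant up to [2 * delta]. *)
Lemma horofunction (G : groupType) (a : isom_action G X) (z : nat -> X) :
  gromov_seq o z -> exists l : X -> R,
  [/\ l o = 0,
      forall x y w M, mheight l x w <= M -> mheight l w y <= M ->
        mheight l x y <= M + delta,
      forall g, gromov_equiv o z (a g \o z) ->
        forall x, `|l (a g x) - l x - l (a g o)| <= 2 * delta &
      forall x w c, (exists N, forall k, (N <= k)%N -> gp x (z k) w <= c) ->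
        mheight l w x <= c + l x].
Proof.
move=> gz; have [U [UU ooU]] := @ultraFilterLemma nat \oo _.
have /choice[l lP] : forall x, exists l, forall e, 0 < e ->
    U [set k | `|mdist o (z k) - mdist x (z k) - l| < e].
  move=> x; apply: (@ultra_lim _ _ _ _ (mdist o x)) => k.
  have := metric_triangle o x (z k); have := metric_triangle x o (z k).
  by rewrite (metric_sym x o) ler_norml => h1 h2; apply/andP; split; lra.
have ev N : U [set k | (N <= k)%N] by apply: ooU; exact: nbhs_infty_ge.
exists l; split.
- apply/eqP; rewrite -normr_eq0 eq_le normr_ge0 andbT.
  apply/ler_addgt0Pl => e e0; have [k /=] := filter_ex (lP o e e0).
  by rewrite subrr sub0r normrN addr0 => /ltW.
- move=> x y w M xw wy; apply/ler_addgt0Pl => e e0.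
  have e20 : 0 < e / 2 by rewrite divr_gt0.
  have [k [[]]] := filter_ex (filterI (filterI (lP x _ e20) (lP y _ e20)) (lP w
    _ e20)).
  rewrite /= !ltr_norml => /andP[x1 x2] /andP[y1 y2] /andP[w1 w2].
  have := hyp x y w (z k); move: xw wy; rewrite /mheight /gp.
  case: (lerP ((mdist x (z k) + mdist w (z k) - mdist x w) / 2)
            ((mdist w (z k) + mdist y (z k) - mdist w y) / 2)) => h; lra.
- move=> g /gromov_equivP gzz x.
  apply/ler_addgt0Pl => e e0; have e20 : 0 < e / 3 by rewrite divr_gt0.
  have [N NP] := gzz (mdist (a g o) o + mdist (a g x) o + delta + 1).
  have [k [[[]]]] := filter_ex (filterI (filterI (filterI (lP x _ e20)
    (lP (a g o) _ e20)) (lP (a g x) _ e20)) (ev N)).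
  rewrite /= !ltr_norml => /andP[x1 x2] /andP[g1 g2] /andP[w1 w2] Nk.
  have kP := NP k k Nk Nk.
  have h1 := @busemann_le (a g o) (a g x) (z k) (a g (z k)).
  have h2 := @busemann_le (a g x) (a g o) (z k) (a g (z k)).
  rewrite !act_isom in h1 h2; rewrite /= in kP.
  have {}h1 := h1 ltac:(lra); have {}h2 := h2 ltac:(lra).
  by rewrite ler_norml; apply/andP; split; lra.
- move=> x w c [N NP]; apply/ler_addgt0Pl => e e0.
  have e20 : 0 < e / 2 by rewrite divr_gt0.
  have [k [[]]] := filter_ex (filterI (filterI (lP x _ e20) (lP w _ e20)) (ev
    N)).
  rewrite /= !ltr_norml => /andP[x1 x2] /andP[w1 w2] /NP.
  rewrite /mheight /gp (metric_sym (z k) x) (metric_sym (z k) w); lra.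
Qed.

End Horofunction.

(** * Groups of isometries that shift heights almost uniformly *)

Section QuasiFixedPoint.
Context {R : realType} {G : groupType} {X : metricType R}.
Variables (a : isom_action G X) (o : X).

Lemma orbit_finite r : proper_space X -> proper_action a ->
  finite_set [set g | mdist o (a g o) <= r].
Proof.
move=> Xp ap; have [r0|r0] := leP 0 r; last first.
  apply: sub_finite_set (finite_set0 G) => g /= gr.
  by have := le_lt_trans gr r0; rewrite ltNge mdist_ge0.
apply: sub_finite_set (ap _ (Xp o r)) => g /= gr.
exists (a g o); split=> //; exists o => //=.
by rewrite mdistxx.
Qed.

Hypothesis orb_fin : forall r, finite_set [set g | mdist o (a g o) <= r].

Variables (delta : R) (l : X -> R) (S : set G).
Hypothesis delta_ge0 : 0 <= delta.
Hypothesis l_o : l o = 0.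
Hypothesis l_ultra : forall x y w M, mheight l x w <= M -> mheight l w y <= M ->
  mheight l x y <= M + delta.
Hypothesis S_mul : forall g h, S g -> S h -> S (g * h)%g.
Hypothesis S_inv : forall g, S g -> S g^-1%g.
Hypothesis S_one : S 1%g.

Lemma mdist_mheight x y : mdist x y = 2 * mheight l x y - l x - l y.
Proof. by rewrite /mheight; lra. Qed.

Section Loxodromic.
Hypothesis l_quasi : forall g, S g -> forall x,
  `|l (a g x) - l x - l (a g o)| <= 2 * delta.

Lemma l_quasi_bounds g x : S g ->
  l x + l (a g o) - 2 * delta <= l (a g x) <= l x + l (a g o) + 2 * delta.
Proof.
by move=> Sg; have := l_quasi Sg x; rewrite ler_norml => /andP[? ?];
  apply/andP; split; lra.
Qed.

Lemma mheight_act g x y : S g ->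
  mheight l (a g x) (a g y) <= mheight l x y + l (a g o) + 2 * delta.
Proof.
move=> Sg; have /andP[_ h1] := l_quasi_bounds x Sg.
have /andP[_ h2] := l_quasi_bounds y Sg.
by rewrite /mheight act_isom; lra.
Qed.

Lemma S_exp h j : S h -> S (h ^+ j)%g.
Proof. by move=> Sh; elim: j => [//|j IH]; rewrite expgS; exact: S_mul. Qed.

Variable h : G.
Hypothesis Sh : S h.
Hypothesis h_up : 4 * delta < l (a h o).
Local Notation L := (l (a h o)).
Local Notation x_ j := (a (h ^+ j)%g o).

Lemma act_expS j : x_ j.+1 = a h (x_ j).
Proof. by rewrite expgS actM. Qed.

Lemma l_exp j : j%:R * (L - 2 * delta) <= l (x_ j).
Proof.
elim: j => [|j IH]; first by rewrite expg0 act1 l_o mul0r.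
have /andP[+ _] := l_quasi_bounds (x_ j) Sh; rewrite -act_expS => h1.
by rewrite mulrSr mulrDl mul1r; lra.
Qed.

(** The points [h^j o] stay near one ray from [o] going up: each merges with [o] only boundedly
    above its own height. The constant does not accumulate, because the [delta] lost in the
    ultrametric inequality at each step is smaller than the gain of height [L - 2 * delta]. *)
Lemma mheight_exp j : mheight l (x_ j) o <= l (x_ j) + (mheight l (a h o) o + 2
  * delta).
Proof.
have d0 := delta_ge0; have hu := h_up.
have m0 : 0 <= mheight l (a h o) o.
  by rewrite /mheight l_o addr0 divr_ge0// addr_ge0 ?mdist_ge0//; lra.
elim: j => [|j IH].
  by rewrite expg0 act1 l_o {1}/mheight mdistxx l_o; lra.
have /andP[+ _] := l_quasi_bounds (x_ j) Sh; rewrite -act_expS => h1.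
have := @l_ultra (x_ j.+1) o (x_ j) (l (x_ j) + (mheight l (a h o) o + 2 *
  delta)).
have : mheight l (x_ j.+1) (x_ j) <= l (x_ j) + (mheight l (a h o) o + 2 *
  delta).
  have := mheight_act (a h o) o (S_exp j Sh).
  rewrite -actM -expgSr; lra.
by move=> h2 /(_ h2 IH) h3; lra.
Qed.

(** High enough, the rays from [o] and [g o] have merged, so [h^j o] and [g h^j o] lie near one ray
    at almost the same height and are close. Applying [h^-j] turns this into a displacement of
    [o]. *)
Lemma loxodromic_close B g : S g -> `|l (a g o)| <= B ->
  exists J, forall j, (J <= j)%N ->
  mdist o (a (h ^- j * g * h ^+ j)%g o) <=
    2 * (mheight l (a h o) o + 2 * delta) + 3 * B + 10 * delta.
Proof.
move=> Sg; rewrite ler_norml => /andP[gB1 gB2]; have d0 := delta_ge0;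
  have hu := h_up.
have Lp : 0 < L - 2 * delta by lra.
(* From this index on, [h^j o] is at least as high as the level where the rays from [o] and [g o]
   merge. *)
exists (Num.truncn (mheight l o (a g o) / (L - 2 * delta))).+1 => j Jj.
have lj : mheight l o (a g o) <= l (x_ j).
  apply: le_trans (l_exp j); rewrite -ler_pdivrMr//.
  by apply: le_trans (ltW (truncnS_gt _)) _; rewrite ler_nat.
have m1 := mheight_exp j; set A := mheight l (a h o) o + 2 * delta in m1 *.
have m2 : mheight l (a g o) (a g (x_ j)) <= l (x_ j) + A + B + 2 * delta.
  by have := mheight_act o (x_ j) Sg; rewrite (mheightC l o); lra.
have A0 : 0 <= A.
  have := mdist_ge0 (a h o) o.
  by rewrite /A {1}/mheight l_o; lra.
have B0 : 0 <= B by lra.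
have m3 : mheight l (x_ j) (a g o) <= l (x_ j) + A + B + 2 * delta + delta.
  by apply: (@l_ultra _ _ o); lra.
have m4 : mheight l (x_ j) (a g (x_ j)) <= l (x_ j) + A + B + 2 * delta + delta
  + delta.
  by apply: (@l_ultra _ _ (a g o)); lra.
have -> : mdist o (a (h ^- j * g * h ^+ j)%g o) = mdist (x_ j) (a g (x_ j)).
  by rewrite -(act_isom a (h ^- j)%g (x_ j)) -!actM mulVg act1.
have /andP[h1 _] := l_quasi_bounds (x_ j) Sg.
by rewrite mdist_mheight; lra.
Qed.

(* For [j] large, [g |-> h^-j g h^j] injects any finite part of this set into a
   fixed finite ball. *)
Lemma loxodromic_finite B : finite_set [set g | S g /\ `|l (a g o)| <= B].
Proof.
set K := 2 * (mheight l (a h o) o + 2 * delta) + 3 * B + 10 * delta.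
have /finite_seqP[s sE] := orb_fin K.
apply: contrapT => /(infinite_set_fset (size s).+1)[F FS].
have [J JP] : exists J, forall g, g \in (F : seq G) ->
    mdist o (a (h ^- J * g * h ^+ J)%g o) <= K.
  have : forall g, g \in (F : seq G) -> S g /\ `|l (a g o)| <= B by move=> g;
    exact: FS.
  suff : forall t : seq G, (forall g, g \in t -> S g /\ `|l (a g o)| <= B) ->
      exists J, forall j, (J <= j)%N -> forall g, g \in t ->
      mdist o (a (h ^- j * g * h ^+ j)%g o) <= K.
    by move=> H /H[J JP]; exists J; exact: JP.
  elim=> [_|y t IH tP]; first by exists 0%N.
  have [J1 J1P] := IH (fun g gt => tP g (mem_behead (s := y :: t) gt)).
  have [Sy yB] := tP y (mem_head _ _).
  have [J2 J2P] := loxodromic_close Sy yB.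
  exists (maxn J1 J2) => j; rewrite geq_max => /andP[j1 j2] g.
  by rewrite in_cons => /predU1P[->|gt]; [exact: J2P|exact: J1P].
apply/negP; rewrite -leqNgt.
rewrite -(size_map (fun g => h ^- J * g * h ^+ J)%g F); apply: uniq_leq_size.
  rewrite map_inj_uniq; first exact: fset_uniq.
  by move=> g1 g2 /mulIg /mulgI.
move=> _ /mapP[g gF ->]; have : [set g | mdist o (a g o) <= K] (h ^- J * g * h
  ^+ J)%g.
  exact: JP.
by rewrite sE.
Qed.

(** Multiplying by [h] or [h^-1] on the right moves the height in a fixed direction, by at least
    [L - 4 * delta] and at most [L + 4 * delta]. The first power to cross level [0] overshoots by at
    most one such step. The threshold in [h_up] makes the steps strictly monotone. *)
Lemma loxodromic_reduce g : S g -> exists2 c, cyclic_subgroup h c &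
  `|l (a (g * c)%g o)| <= L + 4 * delta.
Proof.
move=> Sg; have d0 := delta_ge0; have hu := h_up;
  have Lp : 0 < L - 4 * delta by lra.
have [lg|lg] := leP (l (a g o)) 0.
  have step j : l (a (g * h ^+ j)%g o) + L - 2 * delta <= l (a (g * h ^+ j.+1)%g
    o)
      <= l (a (g * h ^+ j)%g o) + L + 2 * delta.
    have := l_quasi_bounds (a h o) (S_mul Sg (S_exp j Sh)).
    by rewrite -actM expgSr mulgA => /andP[? ?]; apply/andP; split; lra.
  have ex j : l (a g o) + j%:R * (L - 4 * delta) <= l (a (g * h ^+ j)%g o).
    elim: j => [|j IH]; first by rewrite expg0 mulg1 mul0r addr0.
    by have /andP[h1 _] := step j; rewrite mulrSr mulrDl mul1r; lra.
  have exP : exists j, 0 < l (a (g * h ^+ j)%g o).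
    exists (Num.truncn (- l (a g o) / (L - 4 * delta))).+1.
    apply: lt_le_trans (ex _); rewrite -ltrBlDl sub0r -ltr_pdivrMr//.
    exact: truncnS_gt.
  have [[|j]] := ex_minnP exP; first by rewrite expg0 mulg1 ltNge lg.
  move=> jp jm; exists (h ^+ j.+1)%g; first by exists j.+1; left.
  have /andP[_ h2] := step j.
  have : l (a (g * h ^+ j)%g o) <= 0.
    by rewrite leNgt; apply/negP => /jm; rewrite ltnn.
  by move=> h3; rewrite ger0_norm; [lra|exact: ltW].
have ShV := S_inv Sh.
have /andP[V1 V2] : - L - 2 * delta <= l (a h^-1%g o) <= - L + 2 * delta.
  have := l_quasi_bounds (a h^-1%g o) Sh; rewrite -actM mulgV act1 l_o.
  by move=> /andP[? ?]; apply/andP; split; lra.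
have step j : l (a (g * h ^- j)%g o) - L - 4 * delta <= l (a (g * h ^- j.+1)%g
  o)
    <= l (a (g * h ^- j)%g o) - L + 4 * delta.
  have := l_quasi_bounds (a h^-1%g o) (S_mul Sg (S_inv (S_exp j Sh))).
  rewrite -actM -mulgA -invgM -expgS => /andP[? ?]; apply/andP; split; lra.
have ex j : l (a (g * h ^- j)%g o) <= l (a g o) - j%:R * (L - 4 * delta).
  elim: j => [|j IH]; first by rewrite expg0 invg1 mulg1 mul0r subr0.
  by have /andP[_ h1] := step j; rewrite mulrSr mulrDl mul1r; lra.
have exP : exists j, l (a (g * h ^- j)%g o) < 0.
  exists (Num.truncn (l (a g o) / (L - 4 * delta))).+1.
  apply: le_lt_trans (ex _) _; rewrite subr_lt0 -ltr_pdivrMr//.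
  exact: truncnS_gt.
have [[|j]] := ex_minnP exP; first by rewrite expg0 invg1 mulg1 ltNge (ltW lg).
move=> jp jm; exists (h ^- j.+1)%g; first by exists j.+1; right.
have /andP[h2 _] := step j.
have : 0 <= l (a (g * h ^- j)%g o).
  by rewrite leNgt; apply/negP => /jm; rewrite ltnn.
by move=> h3; rewrite ltr0_norm//; lra.
Qed.

Lemma loxodromic_cover : exists2 F : set G, finite_set F &
  S `<=` [set (r * c)%g | r in F & c in cyclic_subgroup h].
Proof.
exists [set g | S g /\ `|l (a g o)| <= L + 4 * delta];
  first exact: loxodromic_finite.
have S_cyc c : cyclic_subgroup h c -> S c.
  by move=> [k [->|->]]; [exact: S_exp|exact/S_inv/S_exp].
move=> g Sg; have [c cc gc] := loxodromic_reduce Sg.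
exists (g * c)%g; first by split=> //; apply: S_mul => //; exact: S_cyc.
exists c^-1%g; last by rewrite mulgK.
by move: cc => [k [->|->]]; exists k; [right|left; rewrite invgK].
Qed.

End Loxodromic.

Lemma quasi_fixed_dichotomy :
  (forall g, S g -> forall x, `|l (a g x) - l x - l (a g o)| <= 2 * delta) ->
  (exists2 h, S h & exists2 F : set G, finite_set F &
    S `<=` [set (r * c)%g | r in F & c in cyclic_subgroup h]) \/
  (forall g, S g -> `|l (a g o)| <= 6 * delta).
Proof.
move=> lq; have d0 := delta_ge0.
have [|no] := pselect (exists2 h, S h & 4 * delta < l (a h o)).
  by move=> [h Sh hL]; left; exists h => //; exact: loxodromic_cover.
(* A height below [- 6 * delta] for [g] gives one above [4 * delta] for [g^-1], since the two
   heights cancel up to [2 * delta]. *)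
right=> g Sg; rewrite ler_norml; apply/andP; split; rewrite leNgt;
  apply/negP => lt.
  apply: no; exists g^-1%g; first exact: S_inv.
  have := l_quasi_bounds lq (a g^-1%g o) Sg; rewrite -actM mulgV act1 l_o.
  by move=> /andP[? ?]; lra.
by apply: no; exists g => //; lra.
Qed.

Section Bounded.
Variable C : R.
Hypothesis l_bounded : forall g, S g -> `|l (a g o)| <= C.

(** Meant for a second fixed boundary point, represented by [w]: orbit points merging with [w] at
    bounded height lie near a rough line between the two points, and such a line meets a band of
    bounded heights in a bounded region. *)
Lemma axis_finite c (w : nat -> X) :
  (forall g, S g -> exists N, forall j, (N <= j)%N -> mheight l (w j) (a g o) <=
    c) ->
  finite_set S.
Proof.
move=> wc; apply: sub_finite_set (orb_fin (2 * (c + delta) + C)) => g Sg /=.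
have [N NP] := wc g Sg; have [M MP] := wc _ S_one; rewrite act1 in MP.
have := @l_ultra o (a g o) (w (maxn N M)) c.
rewrite mheightC => /(_ (MP _ (leq_maxr _ _)) (NP _ (leq_maxl _ _))).
have := l_bounded Sg; rewrite ler_norml (mdist_mheight o) l_o => /andP[? ?] ?.
lra.
Qed.

(* A rough ray from [o] meets the level set [|l| <= C] only near [o] and near
   one other place. *)
Lemma parabolic_count r : exists N, forall (A : set G), A `<=` S ->
  (forall g g', A g -> A g' -> exists y, gromov_product (a g o) o y <= r /\
    gromov_product (a g' o) o y <= r) ->
  exists2 s : seq G, (size s <= N)%N & forall g, A g -> g \in s.
Proof.
set K1 := 2 * (r + delta + C) + C; set K2 := 2 * (r + 2 * delta + C) + 2 * C.
(* A segment from [o] to [y] first climbs and then descends. If [g o] is near it but not near [o],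
   then [g o] and [o] merge high up, so [g o] is on the descending part and merges with [y] at low
   height. [K1] is the distance from which on this merging with [o] is above [r + delta + C]. *)
have key g y : S g -> gromov_product (a g o) o y <= r -> ~ mdist o (a g o) <= K1
  ->
    mheight l y (a g o) <= r + delta + C.
  move=> Sg gy /negP; rewrite -ltNge => far.
  have := l_bounded Sg; rewrite ler_norml => /andP[l1 l2].
  have gpE : gromov_product (a g o) o y = mheight l o (a g o) + mheight l y (a g
    o)
      - mheight l o y - l (a g o).
    by rewrite /gromov_product /mheight; lra.
  rewrite leNgt; apply/negP => gt.
  have := mdist_mheight o (a g o); rewrite l_o => dE.
  have m1 : r + delta + C < mheight l o (a g o) by rewrite /K1 in far; lra.
  have [le|lt] := leP (mheight l o (a g o)) (mheight l y (a g o)).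
    have := @l_ultra o y (a g o) _ le; rewrite (mheightC l _ y) lexx => /(_ isT)
      h.
    by lra.
  have h := @l_ultra o y (a g o) _ (lexx _).
  have {}h := h ltac:(by rewrite mheightC ltW).
  by lra.
have /finite_seqP[s1 s1E] := orb_fin K1; have /finite_seqP[s2 s2E] := orb_fin
  K2.
exists (size s1 + size s2)%N => A AS Ay.
(* Two far elements both merge low with a common [y], hence with each other, and are within [K2]. So
   one far element [g0] locates all the others by a translated ball. *)
have [[g0 Ag0 far0]|near] := pselect (exists2 g0, A g0 & ~ mdist o (a g0 o) <=
  K1).
  exists (s1 ++ map (fun g => g0 * g)%g s2); first by rewrite size_cat size_map.
  move=> g Ag; rewrite mem_cat; have [gK|gK] := pselect (mdist o (a g o) <= K1).
    by have : [set g | mdist o (a g o) <= K1] g by []; rewrite s1E => /= ->.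
  apply/orP; right; apply/mapP; exists (g0^-1 * g)%g; last by rewrite mulVKg.
  have [y [gy g0y]] := Ay _ _ Ag Ag0.
  have k1 := key _ _ (AS _ Ag) gy gK; have k0 := key _ _ (AS _ Ag0) g0y far0.
  rewrite mheightC in k0; have := l_ultra k0 k1 => m.
  suff : [set g | mdist o (a g o) <= K2] (g0^-1 * g)%g by rewrite s2E.
  rewrite /= -(act_isom a g0) -actM mulVKg mdist_mheight.
  have := l_bounded (AS _ Ag); have := l_bounded (AS _ Ag0).
  by clear s1E s2E; rewrite !ler_norml /K2 => /andP[? ?] /andP[? ?]; lra.
exists s1; first exact: leq_addr.
move=> g Ag; have : [set g | mdist o (a g o) <= K1] g.
  by apply: contrapT => far; apply: near; exists g.
by rewrite s1E.
Qed.

End Bounded.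
End QuasiFixedPoint.

(** * The action on the boundary and contraction away from rays *)

Section BoundaryAction.
Context {R : realType} {G : groupType} {X : metricType R}.
Variables (a : isom_action G X) (o : X).
Local Notation gp := gromov_product.
Variable delta : R.
Hypothesis delta_ge0 : 0 <= delta.
Hypothesis hyp : forall x y z w : X,
  Num.min (gp w x z) (gp w z y) - delta <= gp w x y.
Implicit Types (xi eta zeta : boundary o) (g h : G).
Local Notation bact := (boundary_act a).

Lemma gromov_product_isom g (w x y : X) : gp (a g w) (a g x) (a g y) = gp w x y.
Proof. by rewrite /gp !act_isom. Qed.

Lemma mdist_actV g : mdist o (a g^-1%g o) = mdist o (a g o).
Proof. by rewrite -(act_isom a g o) actKV metric_sym. Qed.

Lemma gromov_product_actV g (x y : X) : gp o (a g x) (a g y) = gp (a g^-1%g o) x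
  y.
Proof. by rewrite -(gromov_product_isom g (a g^-1%g o)) actKV. Qed.

Lemma bclass_act g xi x : bclass xi x -> bclass (bact g xi) (a g \o x).
Proof. by move=> xix; exists x. Qed.

Lemma boundary_act1 xi : bact 1%g xi = xi.
Proof.
have [x xix] := bclass_nonempty xi.
apply: (bclass_eq hyp (bclass_act _ xix) xix).
have -> : a 1%g \o x = x by apply/funext => n /=; rewrite act1.
exact: bclass_seq xix.
Qed.

Lemma boundary_actM g h xi : bact (g * h)%g xi = bact g (bact h xi).
Proof.
have [x xix] := bclass_nonempty xi.
apply: (bclass_eq hyp (bclass_act _ xix) (bclass_act g (bclass_act h xix))).
have -> : a (g * h)%g \o x = a g \o (a h \o x) by apply/funext => n /=;
  rewrite actM.
exact: bclass_seq (bclass_act g (bclass_act h xix)).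
Qed.

Lemma boundary_actK g : cancel (bact g) (bact g^-1%g : boundary o -> boundary
  o).
Proof. by move=> xi; rewrite -boundary_actM mulVg boundary_act1. Qed.

Lemma boundary_actVK g : cancel (bact g^-1%g) (bact g : boundary o -> boundary
  o).
Proof. by move=> xi; rewrite -boundary_actM mulgV boundary_act1. Qed.

Lemma bnear_act r g xi eta : bnear r xi eta ->
  bnear (r - mdist o (a g o)) (bact g xi) (bact g eta).
Proof.
move=> xe _ _ [x xix <-] [y etay <-]; have [N NP] := xe x y xix etay.
exists N => n m Nn Nm /=; apply: le_trans (gromov_product_act a o g _ _).
by rewrite lerD2r NP.
Qed.

Lemma boundary_act_open g (U : set (boundary o)) : open U -> open (bact g @^-1`
  U).
Proof.
move=> /(boundary_openE delta_ge0 hyp) oU; apply/(boundary_openE delta_ge0 hyp).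
move=> xi /oU[r rU]; exists (r + mdist o (a g o)) => eta /(bnear_act (g := g)).
by rewrite addrK; exact: rU.
Qed.

Lemma boundary_act_continuous g : continuous (bact g : boundary o -> boundary
  o).
Proof. by apply/continuousP => U; exact: boundary_act_open. Qed.

(* The [g] with [g o] at distance at most about [r] from a rough ray from [o]
   to [xi]. *)
Definition ray_nbhs (r : R) xi : set G :=
  [set g | forall x, bclass xi x ->
    exists N, forall k, (N <= k)%N -> gp (a g o) o (x k) <= r].

Lemma ray_nbhs_pnear r xi g : ray_nbhs r xi g ->
  pnear (mdist o (a g o) - r) (a g o) xi.
Proof.
move=> b x xix; have [N NP] := b x xix; exists N => k /NP.
by have := gromov_product_sum o (a g o) (x k); lra.
Qed.

Lemma not_ray_nbhs r xi g : ~ ray_nbhs r xi g -> forall x, bclass xi x ->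
  exists N, forall k, (N <= k)%N -> r - delta <= gp (a g o) o (x k).
Proof.
move=> nb x xix.
have [|N NP] := @pnear_not _ _ _ hyp o (mdist o (a g o) - r) (a g o) xi _ x xix.
  move=> p; apply: nb => y xiy; have [N NP] := p y xiy; exists N => k /NP.
  by have := gromov_product_sum o (a g o) (y k); lra.
exists N => k /NP.
by have := gromov_product_sum o (a g o) (x k); lra.
Qed.

(** When [g^-1 o] is far from the rays from [o] to [xi] and [eta], both boundary points are seen
    from [g^-1 o] in the direction of [o]. Hyperbolicity through [o] then makes their product at
    [g^-1 o] large. *)
Lemma contraction_bnear r xi eta g :
  ~ ray_nbhs r xi g^-1%g -> ~ ray_nbhs r eta g^-1%g ->
  bnear (r - 2 * delta) (bact g xi) (bact g eta).
Proof.
move=> nxi neta _ _ [x xix <-] [y etay <-].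
have [N NP] := not_ray_nbhs nxi xix; have [M MP] := not_ray_nbhs neta etay.
exists (maxn N M) => n m; rewrite !geq_max => /andP[Nn _] /andP[_ Mm] /=.
have -> : r - 2 * delta = r - delta - delta by lra.
rewrite gromov_product_actV; apply: (@hyperbolic_le _ _ _ hyp _ _ _ o).
  by rewrite gromov_productC NP.
exact: MP.
Qed.

Lemma bnear_not r xi eta : ~ bnear r xi eta ->
  forall x y, bclass xi x -> bclass eta y ->
  exists N, forall n m, (N <= n)%N -> (N <= m)%N -> gp o (x n) (y m) <= r + 2 *
    delta.
Proof.
move=> nr x y xix etay; apply: contrapT => H; apply: nr => x' y' xix' etay'.
have /gromov_equivP/(_ (r + 2 * delta))[M MP] := bclass_equiv hyp xix' xix.
have /gromov_equivP/(_ (r + 2 * delta))[L LP] := bclass_equiv hyp etay etay'.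
exists (maxn M L) => n m; rewrite !geq_max => /andP[Mn Ln] /andP[Mm Lm].
rewrite leNgt; apply/negP => lt; apply: H; exists (maxn M L) => i j.
rewrite !geq_max => /andP[Mi Li] /andP[Mj Lj]; rewrite leNgt; apply/negP => gt.
have h1 := hyperbolic_le hyp (ltW gt) (LP j m Lj Lm).
have h0 : r + 2 * delta - delta <= gp o (x' n) (x i).
  by apply: le_trans (MP n i Mn Mi); have := delta_ge0; lra.
by have := hyperbolic_le hyp h0 h1; lra.
Qed.

End BoundaryAction.

(** * Stationary measures without atoms *)

Section AtomlessStationary.
Context {R : realType} {G : groupType} {X : metricType R}.
Variables (a : isom_action G X) (o : X).
Local Notation gp := gromov_product.
Variable delta : R.
Hypothesis delta_ge0 : 0 <= delta.
Hypothesis hyp : forall x y z w : X,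
  Num.min (gp w x z) (gp w z y) - delta <= gp w x y.
Variables (xi0 : boundary o) (nu : probability (borel_boundary xi0) R).
Variable mu : G -> R.
Hypothesis mu_prob : probability_on mu.
Hypothesis nu_stationary : stationary a mu nu.
Implicit Types (xi eta zeta : boundary o) (g h : G).
Local Notation bact := (boundary_act a).
Local Notation cp := (convolution_power mu).

Lemma open_measurable_boundary (U : set (borel_boundary xi0)) :
  @open (boundary o) U -> measurable U.
Proof. by move=> oU; exact: sub_sigma_algebra. Qed.

Lemma boundary_act_measurable g :
  measurable_fun setT (bact g : borel_boundary xi0 -> borel_boundary xi0).
Proof.
apply: (@measurability _ _ _ _ _ _ ((@open (boundary o)) : set (set
  (borel_boundary xi0)))) => //.
move=> _ [U oU <-]; rewrite setTI; apply: open_measurable_boundary.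
exact: (boundary_act_open delta_ge0 hyp).
Qed.

Lemma measurable_boundary_act_preimage g (A : set (borel_boundary xi0)) :
  measurable A -> measurable (bact g @^-1` A : set (borel_boundary xi0)).
Proof. by move=> mA; rewrite -[X in measurable X]setTI;
  exact: boundary_act_measurable. Qed.

Lemma fine_prob_le1 (A : set (borel_boundary xi0)) : measurable A ->
  0 <= fine (nu A) <= 1.
Proof.
move=> mA; rewrite fine_ge0//= -lee_fin fineK ?probability_le1//.
exact: fin_num_measure.
Qed.

Lemma boundary_singleton_open_compl xi : open (~` [set xi] : set (boundary o)).
Proof.
apply/(boundary_openE delta_ge0 hyp) => eta /= ne.
have [r nr] : exists r, ~ bnear r eta xi.
  apply: contrapT => /forallNP H; apply: ne; apply: (bnear_eq hyp) => r.
  exact: contrapT (H r).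
by exists r => eta' near E; apply: nr; rewrite -E.
Qed.

Lemma boundary_singleton_measurable xi : measurable ([set xi] : set
  (borel_boundary xi0)).
Proof.
rewrite -[X in measurable X]setCK; apply: measurableC;
  apply: open_measurable_boundary.
exact: boundary_singleton_open_compl.
Qed.

Lemma stationary_ex (A : set (borel_boundary xi0)) n : measurable A ->
  ex (cp n) (fun g => fine (nu (bact g @^-1` A))) = fine (nu A).
Proof.
have bnd (B : set (borel_boundary xi0)) : measurable B ->
    bounded_fam (fun g => fine (nu (bact g @^-1` B))).
  move=> mB; exists 1 => g.
  have /andP[h0 h1] := fine_prob_le1 (measurable_boundary_act_preimage g mB).
  by rewrite ger0_norm.
elim: n A => [|n IH] A mA.
  rewrite (ex_convolution_power0 mu_prob (bnd _ mA)).
  by congr (fine (nu _)); apply/seteqP; split=> xi /=;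
    rewrite (boundary_act1 _ hyp).
rewrite (ex_convolution_powerS mu_prob _ (bnd _ mA)).
rewrite -[RHS](IH A mA); apply: eq_ex => g.
have mg := measurable_boundary_act_preimage g mA.
transitivity (ex mu (fun h => fine (nu (bact h @^-1` (bact g @^-1` A))))).
  apply: eq_ex => h; congr (fine (nu _)).
  by apply/seteqP; split=> xi /=; rewrite (boundary_actM _ hyp).
apply: EFin_inj; rewrite exE_ge0//; last 2 first.
- by move=> h; have /andP[] := fine_prob_le1 (measurable_boundary_act_preimage h
  mg).
- exact: bnd.
rewrite fineK ?fin_num_measure//= -(nu_stationary mg); apply: eq_esum => h _.
rewrite EFinM muleC fineK// fin_num_measure//.
exact: measurable_boundary_act_preimage.
Qed.

Hypothesis X_proper : proper_space X.
Variable C : R.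
Hypothesis rough : forall x y : X, exists (T : R) (p : R -> X),
    [/\ 0 <= T, p 0 = x, p T = y &
      forall t t' : R, t \in `[0, T] -> t' \in `[0, T] ->
        `|t - t'| - C <= mdist (p t) (p t') <= `|t - t'| + C].

Lemma bball_measurable r xi : measurable (bball r xi : set (borel_boundary
  xi0)).
Proof. apply: open_measurable_boundary; exact: (bball_open delta_ge0 hyp). Qed.

Lemma atomless_small_balls : (forall xi, nu [set xi] = 0%E) ->
  forall e, 0 < e -> exists r, forall xi, (nu (bball r xi) <= e%:E)%E.
Proof.
move=> atomless e e0.
have small xi : exists m : nat, (nu (bball m%:R xi) < e%:E)%E.
  have cv : nu \o (fun m : nat => bball m%:R xi) @ \oo --> nu [set xi].
    have E : [set xi] = \bigcap_m (bball m%:R xi : set (borel_boundary xi0)).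
      apply/seteqP; split=> [_ -> m _|eta H].
        exact: (bball_center hyp).
      apply/esym; apply: (bnear_eq hyp) => r.
      apply: (@bnear_weaken _ _ _ (Num.truncn r).+1%:R);
        first exact/ltW/truncnS_gt.
      by apply: (bball_bnear hyp); exact: (H _ I).
    rewrite E; apply: nonincreasing_cvg_mu.
    - by rewrite (le_lt_trans (probability_le1 _ _)) ?ltry//;
      exact: bball_measurable.
    - by move=> m; exact: bball_measurable.
    - by rewrite -E; exact: boundary_singleton_measurable.
    - move=> m n mn; apply/subsetPset => eta [s sP]; exists s => eta' /sP.
      by apply: bnear_weaken; rewrite ler_nat.
  have [N _ NP] : \forall m \near \oo, (nu (bball m%:R xi) < e%:E)%E.
    rewrite atomless in cv; suff e_nbhs : nbhs 0%E [set y : \bar R | (y <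
      e%:E)%E].
      exact: (cv _ e_nbhs).
    by apply: open_ereal_lt'; rewrite lte_fin.
  by exists N; exact: (NP N (leqnn _)).
apply: contrapT => /forallNP H.
(* Otherwise there are balls of radius parameter [n] with mass above [e] for every [n]. Near a
   cluster point [zeta] of their centres they would be contained in one fixed ball of mass below
   [e]. *)
have /choice[xi_ xiP] : forall n : nat, exists xi, (e%:E < nu (bball n%:R
  xi))%E.
  move=> n; have /existsNP[xi xiP] := H n%:R; exists xi.
  by rewrite ltNge; exact/negP.
have [zeta zP] := boundary_sequence_compact delta_ge0 hyp X_proper rough xi_.
have [m mP] := small zeta.
(* One [delta] is spent on joining [zeta] to [eta] through [xi_ n], the other on passing from
   [bnear] to the open ball. *)
have [n Nn near] := zP (m%:R + 2 * delta) (Num.truncn (m%:R + 2 * delta)).+1.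
have := xiP n; apply/negP; rewrite -leNgt; apply/ltW; apply: le_lt_trans mP.
apply: le_measure; rewrite ?inE; try exact: bball_measurable.
move=> eta /(bball_bnear hyp) ne; apply: (bnear_bball hyp).
have -> : m%:R + delta = m%:R + 2 * delta - delta by lra.
apply: (bnear_trans hyp near); apply: bnear_weaken ne.
by apply: le_trans (ltW (truncnS_gt _)) _; rewrite ler_nat.
Qed.

Hypothesis orb_fin : forall r, finite_set [set g | mdist o (a g o) <= r].
Hypothesis mu_vanish : forall e : R, 0 < e ->
  exists N, forall n, (N <= n)%N -> forall x, cp n x <= e.

(* If [g o] is far out near the ray to [xi], then [g] maps the complement of a
   small ball of the boundary, hence a set of almost full measure, into a small
   ball around [xi]; stationarity bounds the mass of such [g]. *)
Lemma atomless_ray_vanish r e : (forall xi, nu [set xi] = 0%E) -> 0 < e ->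
  exists N, forall n, (N <= n)%N -> forall xi, ex (cp n) \1_(ray_nbhs a r xi) <=
    e.
Proof.
move=> atomless e0; have d0 := delta_ge0.
(* If [p] is the mass of the far elements near the ray, stationarity gives [(1 - e1) * p <= e1]; as
   [e1 <= 1 / 2], this yields [p <= 2 * e1 <= e / 2]. *)
pose e1 := Num.min (e / 4) (1 / 2).
have e10 : 0 < e1 by rewrite lt_min; apply/andP; split; lra.
have [r1 r1P] := atomless_small_balls atomless e10.
(* Beyond distance [D], both [xi] and the image of any point outside [W] have product at least
   [r1 + 2 * delta] with [g o]. The term [r1 + 3 * delta] is the product bound defining [W], plus
   the [delta] lost in negating it. *)
pose D := r1 + 2 * delta + Num.max r (r1 + 3 * delta).
have /finite_seqP[s sE] := orb_fin D.
have [N NP] := @mu_vanish (e / 2 / (size s).+1%:R) ltac:(by rewrite !divr_gt0).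
exists N => n Nn xi; have cpP := convolution_power_prob mu_prob n.
pose V : set (borel_boundary xi0) := bball r1 xi.
have mV : measurable V by exact: bball_measurable.
pose far := [set g | D < mdist o (a g o)].
have big g : ray_nbhs a r xi g -> far g ->
    1 - e1 <= fine (nu (bact g @^-1` V)).
  move=> /ray_nbhs_pnear pxi farg.
  (* [W] is the part of the boundary in the direction of [g^-1 o], the only part that [g] may fail
     to send near [xi]. It is contained in a ball around any of its points, so its complement has
     almost full mass. *)
  pose W := [set eta : borel_boundary xi0 | pnear (r1 + 2 * delta) (a g^-1%g o)
    eta].
  have WV : ~` W `<=` bact g @^-1` V.
    move=> eta neta; apply: (bnear_bball hyp).
    have -> : r1 + delta = r1 + 2 * delta - delta by lra.
    have far_r : r1 + 2 * delta <= mdist o (a g o) - r.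
      by move: farg; rewrite /far /D/= -ltrBrDl gt_max => /andP[? ?]; lra.
    have far_r1 : r1 + 2 * delta <= mdist o (a g o) - (r1 + 3 * delta).
      by move: farg; rewrite /far /D/= -ltrBrDl gt_max => /andP[? ?]; lra.
    apply: (pnear_bnear hyp (p := a g o)); first exact: pnear_weaken pxi.
    apply: (pnear_weaken far_r1) => _ [y etay <-].
    have [k kP] := pnear_not hyp neta etay.
    exists k => m km /=; have := kP m km.
    have := gromov_product_sum o (a g^-1%g o) (y m).
    by rewrite -gromov_product_actV mdist_actV; lra.
  have [[eta0 Weta0]|noW] := pselect (exists eta0, W eta0); last first.
    have -> : bact g @^-1` V = setT.
      apply/seteqP; split=> // eta _; apply: WV => Weta.
      by apply: noW; exists eta.
    by rewrite probability_setT/=; lra.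
  have WB : W `<=` (bball r1 eta0 : set (borel_boundary xi0)).
    move=> eta Weta; apply: (bnear_bball hyp).
    have -> : r1 + delta = r1 + 2 * delta - delta by lra.
    exact: (pnear_bnear hyp) Weta0 Weta.
  have mB := bball_measurable r1 eta0.
  have mCB : measurable (~` (bball r1 eta0 : set (borel_boundary xi0))).
    exact: measurableC.
  have mgV := measurable_boundary_act_preimage g mV.
  rewrite -lee_fin fineK ?fin_num_measure//.
  apply: le_trans (_ : nu (~` (bball r1 eta0)) <= _)%E; last first.
    apply: le_measure; rewrite ?inE// => eta neta; apply: WV => Weta.
    by apply: neta; exact: WB.
  by rewrite probability_setC// EFinB leeB// r1P.
have e1_half : e1 <= 1 / 2 by rewrite ge_min lexx orbT.
have e1_e : e1 <= e / 4 by rewrite ge_min lexx.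
have nuV : ex (cp n) (fun g => fine (nu (bact g @^-1` V))) <= e1.
  by rewrite stationary_ex// -lee_fin fineK ?fin_num_measure//; exact: r1P.
have bV : bounded_fam (fun g => fine (nu (bact g @^-1` V))).
  exists 1 => g; have /andP[h0 h1] := fine_prob_le1
    (measurable_boundary_act_preimage g mV).
  by rewrite ger0_norm.
have farP : ex (cp n) \1_(ray_nbhs a r xi `&` far) <= e / 2.
  have : ex (cp n) (fun g => (1 - e1) * \1_(ray_nbhs a r xi `&` far) g) <= e1.
    apply: le_trans nuV; apply: ex_le => //.
      by apply: bounded_famM; [exact: bounded_fam_cst|exact: bounded_fam_indic].
    move=> g; rewrite indicE; case: (boolP (g \in _)) => [|_].
      by rewrite inE mulr1 => -[]; exact: big.
    rewrite mulr0.
    by have /andP[] := fine_prob_le1 (measurable_boundary_act_preimage g mV).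
  rewrite exZ//; last exact: bounded_fam_indic.
  have := ex_ge0 cpP (f := \1_(ray_nbhs a r xi `&` far)) ltac:(by move=> g;
    rewrite indicE; case: (_ \in _)).
  nra.
have nearP : ex (cp n) \1_(ray_nbhs a r xi `\` far) <= e / 2.
  apply: le_trans (ex_indic_seq cpP (s := s) (e := e / 2 / (size s).+1%:R) _ _)
    _.
  - move=> g [_ /negP]; rewrite -leNgt => gD.
    by have : [set g | mdist o (a g o) <= D] g by []; rewrite sE.
  - exact: NP.
  - rewrite mulrCA ler_piMr//; first by rewrite divr_ge0// ltW.
    by rewrite ler_pdivrMr ?mul1r ?ler_nat.
have -> : ray_nbhs a r xi = (ray_nbhs a r xi `&` far) `|` (ray_nbhs a r xi `\`
  far).
  by rewrite setUIDK.
apply: le_trans (ex_indicU cpP _ _) _; lra.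
Qed.

End AtomlessStationary.

(** * The group generated by the support *)

Section GeneratedGroup.
Context {R : realType} {G : groupType}.
Variable mu : G -> R.
Hypothesis mu_prob : probability_on mu.
Hypothesis mu_sym : symmetric_measure mu.
Local Notation cp := (convolution_power mu).
Local Notation Gamma := (generated_semigroup (support_of mu)).

Lemma generated_support g : mu g != 0 -> Gamma g.
Proof. by move=> mg A [_]; apply. Qed.

Lemma generated_mul g h : Gamma g -> Gamma h -> Gamma (g * h)%g.
Proof. move=> Gg Gh A AP; have [AM _] := AP.
by apply: AM; [exact: (Gg A AP)|exact: (Gh A AP)]. Qed.

Lemma generated_inv g : Gamma g -> Gamma g^-1%g.
Proof.
move=> Gg; apply: (Gg [set g | Gamma g^-1%g]); split=> [h k /= Gh Gk|h /= mh].
  by rewrite invgM; exact: generated_mul.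
by apply: generated_support; rewrite -mu_sym.
Qed.

Lemma generated_one : Gamma 1%g.
Proof.
have [s s0] := support_nonempty mu_prob; rewrite -(mulgV s).
have Gs := generated_support s0.
exact: (generated_mul Gs (generated_inv Gs)).
Qed.

Lemma finite_virtually_cyclic (S : set G) : S 1%g -> finite_set S ->
  virtually_cyclic S.
Proof.
move=> S1 finS; exists 1%g => //; exists S => // g Sg; exists g => //.
exists 1%g; last by rewrite mulg1.
by exists 0%N; left.
Qed.

Lemma convolution_power_support n g : cp n g != 0 -> Gamma g.
Proof.
elim: n g => [|n IH] g.
  rewrite /convolution_power/=; case: (g =P 1%g) => [-> _|_];
    first exact: generated_one.
  by rewrite eqxx.
move=> ng0; apply: contrapT => nG; move/eqP: ng0; apply.
have cpn := convolution_power_prob mu_prob n.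
apply: EFin_inj; rewrite convolution_powerS convolutionE// esum1// => h _.
have [->|nh] := eqVneq (cp n h) 0; first by rewrite mul0r.
have [->|mh] := eqVneq (mu (h^-1 * g)%g) 0; first by rewrite mulr0.
exfalso; apply: nG; rewrite -[g](mulVKg h).
exact: (generated_mul (IH _ nh) (generated_support mh)).
Qed.

Lemma ex_indic_support n (A : set G) :
  ex (cp n) \1_A = ex (cp n) \1_(A `&` Gamma).
Proof.
rewrite !ex.unlock; congr gsum; apply/funext => g; rewrite !indicE in_setI.
have [->|ng] := eqVneq (cp n g) 0; first by rewrite !mulr0.
by rewrite [g \in Gamma]mem_set ?andbT//; exact: convolution_power_support ng.
Qed.

End GeneratedGroup.

(** * Stationary measures with atoms *)

Section AtomicStationary.
Context {R : realType} {G : groupType} {X : metricType R}.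
Variables (a : isom_action G X) (o : X).
Local Notation gp := gromov_product.
Variable delta : R.
Hypothesis delta_ge0 : 0 <= delta.
Hypothesis hyp : forall x y z w : X,
  Num.min (gp w x z) (gp w z y) - delta <= gp w x y.
Variables (xi0 : boundary o) (nu : probability (borel_boundary xi0) R).
Variable mu : G -> R.
Hypothesis mu_prob : probability_on mu.
Hypothesis mu_sym : symmetric_measure mu.
Hypothesis nu_stationary : stationary a mu nu.
Implicit Types (xi eta zeta : boundary o) (g h : G).
Local Notation bact := (boundary_act a).
Local Notation cp := (convolution_power mu).
Local Notation Gamma := (generated_semigroup (support_of mu)).

Let atom xi : R := fine (nu [set xi]).

Let atomE xi : (atom xi)%:E = nu [set xi].
Proof.
rewrite /atom fineK// fin_num_measure//.
exact: (boundary_singleton_measurable delta_ge0 hyp).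
Qed.

Lemma finite_large_atoms t : 0 < t -> finite_set [set xi | t <= atom xi].
Proof.
move=> t0; apply: contrapT => /(infinite_set_fset (Num.truncn (1 / t)).+1)[F FA
  Fs].
have mF (i : borel_boundary xi0) : measurable [set i].
  exact: (boundary_singleton_measurable delta_ge0 hyp).
have : (nu (\bigcup_(i in [set` F]) [set i]) <= 1)%E.
  by apply: probability_le1; apply: fin_bigcup_measurable => // i _; exact: mF.
rewrite measure_fin_bigcup//; last first.
- by move=> i j _ _ [k [/= -> ->]].
rewrite fsbig_finite//= set_fsetK.
rewrite (eq_bigr (fun i => (atom i)%:E)); last by move=> i _; rewrite atomE.
rewrite sumEFin lee_fin; apply/negP; rewrite -ltNge.
apply: (@lt_le_trans _ _ (\sum_(i <- F) t)).
  rewrite big_const_seq count_predT iter_addr_0 -[_ *+ _]mulr_natl.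
  rewrite -ltr_pdivrMr//; apply: lt_le_trans (truncnS_gt _) _.
  by rewrite ler_nat.
rewrite big_seq [leRHS]big_seq; apply: ler_sum => i iF.
exact: FA.
Qed.

Lemma maximal_atom : (exists xi, nu [set xi] != 0%E) ->
  exists2 zeta, 0 < atom zeta & forall xi, atom xi <= atom zeta.
Proof.
move=> [xi xi_gt0].
have a0 : 0 < atom xi.
  by rewrite lt0r -(inj_eq (@EFin_inj _)) atomE xi_gt0 fine_ge0.
have /finite_seqP[s sE] := finite_large_atoms a0.
have [zeta zP] : exists zeta, forall eta, eta \in xi :: s -> atom eta <= atom
  zeta.
  elim: (xi :: s) => [|y t [zeta zP]]; first by exists xi.
  have [h|h] := leP (atom y) (atom zeta).
    by exists zeta => eta; rewrite in_cons => /predU1P[->|/zP].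
  exists y => eta; rewrite in_cons => /predU1P[->//|/zP]; move=> h'.
  exact: le_trans h' (ltW h).
have xz := zP xi (mem_head _ _).
exists zeta; first exact: lt_le_trans xz.
move=> eta; have [h|h] := leP (atom xi) (atom eta);
  last exact: le_trans (ltW h) xz.
apply: zP; rewrite in_cons; apply/orP; right.
by have : [set xi' | atom xi <= atom xi'] eta by []; rewrite sE.
Qed.

(** Maximum principle: by stationarity the mass at [xi] is the [mu]-mean of the masses at [s^-1 xi].
    If it is maximal, each term with [mu s] positive is maximal too. *)
Lemma maximal_atom_invariant zeta : (forall xi, atom xi <= atom zeta) ->
  forall g, Gamma g -> forall xi, atom xi = atom zeta ->
  atom (bact g xi) = atom zeta.
Proof.
move=> zmax.
have supp s xi : mu s != 0 -> atom xi = atom zeta ->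
    atom (bact s^-1%g xi) = atom zeta.
  move=> ms xiz.
  have mxi : measurable ([set xi] : set (borel_boundary xi0)).
    exact: (boundary_singleton_measurable delta_ge0 hyp).
  have batom : bounded_fam (fun g => atom (bact g^-1%g xi)).
    by exists (atom zeta) => g; rewrite ger0_norm ?zmax// fine_ge0.
  have E : ex mu (fun g => atom (bact g^-1%g xi)) = atom xi.
    rewrite -[RHS](stationary_ex delta_ge0 hyp mu_prob nu_stationary 1 mxi).
    have pre g : (bact g @^-1` [set xi]) = [set bact g^-1%g xi].
      apply/seteqP; split=> [eta /= <-|_ ->] /=.
        by rewrite (boundary_actK _ hyp).
      by rewrite (boundary_actVK _ hyp).
    rewrite ex_convolution_power1//.
      by apply: eq_ex => g; rewrite pre.
    have [M MP] := batom; exists M => g; rewrite pre; exact: MP.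
  have := @ex_ge_term _ _ mu mu_prob (fun g => atom zeta - atom (bact g^-1%g
    xi)) s.
  rewrite exB//; last exact: bounded_fam_cst.
  rewrite ex_cst// E xiz subrr => H.
  have {}H := H (fun g => ltac:(by rewrite subr_ge0)).
  have {}H := H (bounded_famB (bounded_fam_cst _ _) batom).
  have ms0 : 0 < mu s by rewrite lt0r ms mu_prob.1.
  apply/eqP; rewrite eq_le zmax/= -subr_le0.
  by rewrite -(pmulr_lle0 _ ms0).
move=> g Gg; apply: (Gg [set g | forall xi, atom xi = atom zeta ->
  atom (bact g xi) = atom zeta]); split=> [h k /= Hh Hk xi xiz|h /= mh xi xiz].
  by rewrite (boundary_actM _ hyp); apply/Hh/Hk.
by rewrite -(invgK h); apply: supp => //; rewrite -mu_sym.
Qed.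

Hypothesis X_proper : proper_space X.
Hypothesis a_proper : proper_action a.
Hypothesis mu_nonelementary : nonelementary_measure mu.

(** The images of the pair [(zeta, zeta')] lie in the finite set [F x F]. One group element for each
    attained image gives the finite set of coset representatives. *)
Lemma stabilizer_finite_index (F : set (boundary o)) zeta zeta' :
  finite_set F -> F zeta -> F zeta' ->
  (forall g, Gamma g -> forall xi, F xi -> F (bact g xi)) ->
  exists2 T : set G, finite_set T & forall g, Gamma g -> exists2 t, T t &
    [/\ Gamma (t^-1 * g)%g, bact (t^-1 * g)%g zeta = zeta &
      bact (t^-1 * g)%g zeta' = zeta'].
Proof.
move=> finF Fz Fz' FG.
have /choice[t tP] : forall p : boundary o * boundary o, exists t,
    (exists g, [/\ Gamma g, bact g zeta = p.1 & bact g zeta' = p.2]) ->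
    [/\ Gamma t, bact t zeta = p.1 & bact t zeta' = p.2].
  move=> p; have [[g gP]|no] := pselect (exists g,
    [/\ Gamma g, bact g zeta = p.1 & bact g zeta' = p.2]); first by exists g.
  by exists 1%g => /no.
exists (t @` (F `*` F)); first by apply: finite_image; exact: finite_setX.
move=> g Gg; set p := (bact g zeta, bact g zeta').
have [Gt tz tz'] : [/\ Gamma (t p), bact (t p) zeta = p.1 & bact (t p) zeta' =
  p.2].
  by apply: tP; exists g.
exists (t p); first by exists p => //; split=> /=; exact: FG.
split; first by apply: generated_mul => //; exact: generated_inv.
  by rewrite (boundary_actM _ hyp) -[bact g zeta]/(p.1) -tz (boundary_actK _
    hyp).
by rewrite (boundary_actM _ hyp) -[bact g zeta']/(p.2) -tz' (boundary_actK _
  hyp).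
Qed.

(* The maximal atoms form a finite invariant set [F]. If the stabilizer of two
   of its points contains a loxodromic element, or if the two points are
   distinct, then the group is virtually cyclic. Otherwise the group fixes a
   point and quasi-preserves its horospheres, and a ray contains boundedly many
   orbit points near a horosphere. *)
Lemma atomic_ray_count r : (exists xi, nu [set xi] != 0%E) ->
  exists N, forall xi, exists2 s : seq G, (size s <= N)%N &
    forall g, (ray_nbhs a r xi `&` Gamma) g -> g \in s.
Proof.
move=> /maximal_atom[zeta z0 zmax].
pose F := [set xi | atom xi = atom zeta].
have finF : finite_set F.
  by apply: sub_finite_set (finite_large_atoms z0) => xi /= ->.
have FG g : Gamma g -> forall xi, F xi -> F (bact g xi).
  by move=> Gg xi; exact: maximal_atom_invariant.
have orb_fin q : finite_set [set g | mdist o (a g o) <= q].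
  exact: orbit_finite.
(* A second maximal atom if there is one, and [zeta] itself otherwise; this lets one stabilizer [S]
   serve both cases. *)
have [zeta' [Fz' zz']] : exists zeta', F zeta' /\ (zeta' = zeta -> F = [set
  zeta]).
  have [[eta Feta ne]|no] := pselect (exists2 eta, F eta & eta <> zeta).
    by exists eta; split.
  exists zeta; split=> // _; apply/seteqP; split=> [eta Feta|_ ->//].
  by apply: contrapT => ne; apply: no; exists eta.
have [T finT TP] := stabilizer_finite_index finF erefl Fz' FG.
pose S := [set g | [/\ Gamma g, bact g zeta = zeta & bact g zeta' = zeta']].
have S_one : S 1%g by split; [exact: generated_one|exact: (boundary_act1 _
  hyp)..].
have S_mul g h : S g -> S h -> S (g * h)%g.
  move=> [Gg gz gz'] [Gh hz hz']; split; first exact: generated_mul.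
    by rewrite (boundary_actM _ hyp) hz.
  by rewrite (boundary_actM _ hyp) hz'.
have S_inv g : S g -> S g^-1%g.
  move=> [Gg gz gz']; split; first exact: generated_inv.
    by rewrite -{1}gz (boundary_actK _ hyp).
  by rewrite -{1}gz' (boundary_actK _ hyp).
have [z zz] := bclass_nonempty zeta; have [w ww] := bclass_nonempty zeta'.
have [l [l_o l_ultra l_quasi l_gp]] := horofunction hyp a (bclass_seq zz).
have zS g : S g -> forall x, `|l (a g x) - l x - l (a g o)| <= 2 * delta.
  move=> [_ gz _]; apply: l_quasi; apply: (bclass_equiv hyp zz).
  by have := bclass_act a g zz; rewrite gz.
have [[h Sh [F' finF' F'S]]|bounded] :=
    quasi_fixed_dichotomy orb_fin delta_ge0 l_o l_ultra S_mul S_inv S_one zS.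
  exfalso; apply: mu_nonelementary; exists h; first by case: Sh.
  exists [set (t * f)%g | t in T & f in F']; first exact: finite_image2.
  move=> g /TP[t Tt tg]; have [f Ff [c cc fc]] := F'S _ tg.
  exists (t * f)%g; first by exists t => //; exists f.
  by exists c => //; rewrite -mulgA fc mulVKg.
have [zeq|zne] := pselect (zeta' = zeta); last first.
  exfalso; apply: mu_nonelementary; apply: finite_virtually_cyclic.
    exact: generated_one.
  suff finS : finite_set S.
    apply: (@sub_finite_set _ _ [set (t * s)%g | t in T & s in S]).
      move=> g /TP[t Tt tg]; exists t => //; exists (t^-1 * g)%g => //.
      by rewrite mulVKg.
    exact: finite_image2.
  (* For [g] in [S], the sequences [g^-1 z] and [g^-1 w] still represent [zeta] and [zeta']. So the
     product of [z] and [w] based at [g o] is at most [q + 2 * delta], uniformly in [g]; the further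
     [6 * delta] below is the bound on the height of [g o]. *)
  have [q nq] : exists q, ~ bnear q zeta zeta'.
    apply: contrapT => /forallNP H; apply: zne; apply/esym/(bnear_eq hyp) => q.
    exact: contrapT (H q).
  apply: (axis_finite orb_fin l_o l_ultra S_one bounded
    (c := q + 2 * delta + 6 * delta) (w := w)) => g Sg.
  have [_ gz gz'] := S_inv _ Sg.
  have gzz := bclass_act a g^-1%g zz; have gww := bclass_act a g^-1%g ww.
  rewrite gz in gzz; rewrite gz' in gww.
  have [N NP] := bnear_not delta_ge0 hyp nq gzz gww.
  exists N => j Nj; have := bounded _ Sg; rewrite ler_norml => /andP[_ lg].
  apply: (le_trans (l_gp (a g o) (w j) (q + 2 * delta) _)); last by lra.
  exists N => k Nk; have := NP k j Nk Nj => /=.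
  by rewrite gromov_product_actV invgK.
(* Only [zeta' = zeta] is left, so [zeta] is the unique maximal atom, and the invariance of [F]
   makes it a fixed point of the whole group. *)
have GS : Gamma `<=` S.
  have fixz g : Gamma g -> bact g zeta = zeta.
    by move=> Gg; have := FG g Gg zeta erefl; rewrite (zz' zeq).
  by move=> g Gg; split=> //; rewrite ?zeq; exact: fixz.
have [N NP] := parabolic_count orb_fin l_o l_ultra bounded r.
exists N => xi; have [x xix] := bclass_nonempty xi.
have [||s sN sP] := NP (ray_nbhs a r xi `&` Gamma).
- by move=> g [_ /GS].
- move=> g g' [gb _] [g'b _]; have [n nP] := gb x xix; have [m mP] := g'b x xix.
  by exists (x (maxn n m)); split; [apply: nP; exact: leq_maxl|apply: mP;
    exact: leq_maxr].
by exists s.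
Qed.

Lemma generated_infinite : ~ finite_set Gamma.
Proof.
by move=> /(finite_virtually_cyclic (generated_one mu_prob mu_sym));
  exact: mu_nonelementary.
Qed.

Lemma atomic_ray_vanish r e : (exists xi, nu [set xi] != 0%E) -> 0 < e ->
  exists N, forall n, (N <= n)%N -> forall xi, ex (cp n) \1_(ray_nbhs a r xi) <=
    e.
Proof.
move=> /(atomic_ray_count r)[K KP] e0.
have [N NP] := convolution_power_vanish mu_prob mu_sym generated_infinite
  (e := e / K.+1%:R) ltac:(by rewrite divr_gt0).
exists N => n Nn xi; have [s sK sP] := KP xi; rewrite ex_indic_support//.
apply: le_trans (ex_indic_seq (convolution_power_prob mu_prob n) sP (NP n Nn))
  _.
rewrite mulrCA ler_piMr//; first exact: ltW.
by rewrite ler_pdivrMr// mul1r ler_nat leqW.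
Qed.

Variable C : R.
Hypothesis rough : forall x y : X, exists (T : R) (p : R -> X),
    [/\ 0 <= T, p 0 = x, p T = y &
      forall t t' : R, t \in `[0, T] -> t' \in `[0, T] ->
        `|t - t'| - C <= mdist (p t) (p t') <= `|t - t'| + C].

Theorem ray_vanish r e : 0 < e ->
  exists N, forall n, (N <= n)%N -> forall xi, ex (cp n) \1_(ray_nbhs a r xi) <=
    e.
Proof.
move=> e0; have [atoms|] := pselect (exists xi, nu [set xi] != 0%E).
  exact: atomic_ray_vanish.
move=> noatom; apply: (atomless_ray_vanish delta_ge0 hyp mu_prob nu_stationary
  X_proper rough) => //.
- by move=> q; exact: orbit_finite.
- exact: convolution_power_vanish generated_infinite.
- move=> xi; apply: contrapT => /eqP h; apply: noatom; exists xi.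
  exact: h.
Qed.

End AtomicStationary.

Lemma countable_enum (G : choiceType) : countable [set: G] ->
  exists (f : G -> nat) (e : nat -> option G),
  [/\ injective f, forall g, e (f g) = Some g & forall k g, e k = Some g -> f g
    = k].
Proof.
move=> /countable_injP[f finj]; exists f.
have /choice[e eP] : forall k, exists og : option G,
    (forall g, og = Some g -> f g = k) /\ (og = None -> forall g, f g <> k).
  move=> k; have [[g gk]|no] := pselect (exists g, f g = k).
    by exists (Some g); split=> // _ [<-].
  by exists None; split=> // _ g gk; apply: no; exists g.
have inj : injective f by move=> g h; apply: finj; rewrite inE.
exists e; split=> // [g|k g]; last by have [] := eP k => + _; apply.
have [eS eN] := eP (f g); case: (e (f g)) eS eN => [h hS _|_ /(_ erefl g)//].
by congr Some; apply: inj; exact: hS.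
Qed.

Lemma esum_enum (R : realType) (G : choiceType) (f : G -> nat) (e : nat ->
  option G)
    (F : G -> \bar R) :
  injective f -> (forall g, e (f g) = Some g) ->
  (forall k g, e k = Some g -> f g = k) -> (forall g, 0 <= F g)%E ->
  (\esum_(g in [set: G]) F g = \sum_(0 <= k <oo) oapp F 0 (e k))%E.
Proof.
move=> finj ef fe F0; rewrite nneseries_esumT; last by move=> k; case: (e k).
transitivity (\esum_(k in f @` [set: G]) oapp F 0 (e k))%E.
  rewrite esum_image; last by move=> g h _ _; exact: finj.
  by apply: eq_esum => g _; rewrite ef.
rewrite esum_mkcond; apply: eq_esum => k _; case: ifPn => //.
rewrite notin_setE => nk; case ek : (e k) => [g|//].
by exfalso; apply: nk; exists g => //; exact: fe.
Qed.

(** * Uniform contraction and convergence of the means *)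

Section Equidistribution.
Context {R : realType} {G : groupType} {X : metricType R}.
Variables (a : isom_action G X) (o : X).
Local Notation gp := gromov_product.
Variable delta : R.
Hypothesis delta_ge0 : 0 <= delta.
Hypothesis hyp : forall x y z w : X,
  Num.min (gp w x z) (gp w z y) - delta <= gp w x y.
Variables (xi0 : boundary o) (nu : probability (borel_boundary xi0) R).
Variable mu : G -> R.
Hypothesis mu_prob : probability_on mu.
Hypothesis mu_sym : symmetric_measure mu.
Hypothesis nu_stationary : stationary a mu nu.
Hypothesis X_proper : proper_space X.
Hypothesis a_proper : proper_action a.
Hypothesis mu_nonelementary : nonelementary_measure mu.
Variable C : R.
Hypothesis rough : forall x y : X, exists (T : R) (p : R -> X),
    [/\ 0 <= T, p 0 = x, p T = y &
      forall t t' : R, t \in `[0, T] -> t' \in `[0, T] ->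
        `|t - t'| - C <= mdist (p t) (p t') <= `|t - t'| + C].
Implicit Types (xi eta zeta : boundary o) (g h : G) (phi psi : boundary o -> R).
Local Notation bact := (boundary_act a).
Local Notation cp := (convolution_power mu).

Let cpP := convolution_power_prob mu_prob.

Lemma uniformly_continuous phi e : continuous phi -> 0 < e ->
  exists r, forall xi eta, bnear r xi eta -> `|phi xi - phi eta| < e.
Proof.
move=> cphi e0; apply: contrapT => /forallNP H.
have /choice[p pP] : forall n : nat, exists p : boundary o * boundary o,
    bnear n%:R p.1 p.2 /\ e <= `|phi p.1 - phi p.2|.
  move=> n; have /existsNP[xi /existsNP[eta /not_implyP[near far]]] := H n%:R.
  by exists (xi, eta); split=> //=; rewrite leNgt; exact/negP.
have [zeta zP] := boundary_sequence_compact delta_ge0 hyp X_proper rough (fst \o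
  p).
have [r rP] := continuous_bnear delta_ge0 hyp zeta cphi
  (e := e / 2) ltac:(by rewrite divr_gt0).
have [n Nn near] := zP (r + delta) (Num.truncn (r + delta)).+1.
have [near' far] := pP n.
have rn : r + delta <= n%:R.
  by apply: le_trans (ltW (truncnS_gt _)) _; rewrite ler_nat.
have h1 : `|phi zeta - phi (p n).1| < e / 2.
  by apply: rP; apply: bnear_weaken near; rewrite lerDl.
have h2 : `|phi zeta - phi (p n).2| < e / 2.
  apply: rP; rewrite -[r](addrK delta).
  exact: (bnear_trans hyp) near (bnear_weaken rn near').
move: far; apply/negP; rewrite -ltNge.
rewrite distrC in h1.
have := ler_normD (phi (p n).1 - phi zeta) (phi zeta - phi (p n).2).
by rewrite addrA subrK; lra.
Qed.

Lemma continuous_bounded phi : continuous phi ->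
  exists2 M, 0 < M & forall xi, `|phi xi| <= M.
Proof.
move=> cphi; apply: contrapT => H.
have /choice[xi_ xP] : forall n : nat, exists xi, n.+1%:R < `|phi xi|.
  move=> n; apply: contrapT => /forallNP h; apply: H; exists n.+1%:R => // xi.
  by rewrite leNgt; exact/negP.
have [zeta zP] := boundary_sequence_compact delta_ge0 hyp X_proper rough xi_.
have [r rP] := continuous_bnear delta_ge0 hyp zeta cphi ltr01.
have [n Nn near] := zP r (Num.truncn (`|phi zeta| + 1)).
have h1 := rP _ near; have h2 := xP n.
have h3 : `|phi zeta| + 1 < n.+1%:R.
  by apply: lt_le_trans (truncnS_gt _) _; rewrite ler_nat.
have := ler_normD (phi (xi_ n) - phi zeta) (phi zeta).
by rewrite subrK distrC; lra.
Qed.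

Lemma contraction phi e : continuous phi -> 0 < e ->
  exists N, forall n, (N <= n)%N -> forall xi eta,
  ex (cp n) (fun g => `|phi (bact g xi) - phi (bact g eta)|) <= e.
Proof.
move=> cphi e0; have [M M0 MP] := continuous_bounded cphi.
have [r rP] := uniformly_continuous cphi (e := e / 2) ltac:(by rewrite
  divr_gt0).
(* The shift [2 * delta] is the loss in [contraction_bnear]. On each of the two exceptional sets the
   difference is at most [2 * M], which costs [2 * M * 2 * e / (8 * M) = e / 2] in total. *)
have [N NP] := ray_vanish delta_ge0 hyp mu_prob mu_sym nu_stationary X_proper
  a_proper mu_nonelementary rough (r + 2 * delta)
  (e := e / (8 * M)) ltac:(by rewrite divr_gt0// mulr_gt0).
exists N => n Nn xi eta.
pose B zeta g : R := \1_(ray_nbhs a (r + 2 * delta) zeta) g^-1%g.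
have bB zeta : bounded_fam (B zeta).
  by apply: (@bounded_fam_comp _ _ _ (fun g => g^-1)%g);
    exact: bounded_fam_indic.
have EB zeta : ex (cp n) (B zeta) <= e / (8 * M).
  rewrite (ex_convolution_powerV mu_prob _ mu_sym);
    last exact: bounded_fam_indic.
  exact: NP.
have bphi zeta : bounded_fam (fun g => phi (bact g zeta)) by exists M.
have bBB : bounded_fam (fun g => 2 * M * (B xi g + B eta g)).
  by apply: bounded_famM; [exact: bounded_fam_cst|exact: bounded_famD].
apply: (@le_trans _ _ (ex (cp n) (fun g => e / 2 + 2 * M * (B xi g + B eta
  g)))).
  apply: ex_le => //.
  - by apply: bounded_fam_abs; exact: bounded_famB.
  - by apply: bounded_famD => //; exact: bounded_fam_cst.
  move=> g; rewrite /B !indicE.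
  have two : `|phi (bact g xi) - phi (bact g eta)| <= 2 * M.
    apply: le_trans (ler_normB _ _) _.
    by have := MP (bact g xi); have := MP (bact g eta); lra.
  case: (boolP (g^-1%g \in ray_nbhs a (r + 2 * delta) xi)) => [_|/negP nxi].
    by case: (_ \in _) => /=; lra.
  case: (boolP (g^-1%g \in ray_nbhs a (r + 2 * delta) eta)) => [_|/negP neta]
    /=.
    by lra.
  have : `|phi (bact g xi) - phi (bact g eta)| < e / 2.
    apply: rP; rewrite -[r](addrK (2 * delta)).
    by apply: (contraction_bnear hyp) => h; [apply: nxi|apply: neta];
      rewrite inE.
  by lra.
rewrite exD//; last exact: bounded_fam_cst.
rewrite ex_cst// exZ//; last exact: bounded_famD.
rewrite exD//.
have eE : e = e / 2 + 2 * M * (e / (8 * M) + e / (8 * M)) by field;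
  rewrite gt_eqF.
by rewrite [leRHS]eE lerD2l ler_wpM2l ?lerD// mulr_ge0// ltW.
Qed.

Lemma continuous_measurable_boundary phi : continuous phi ->
  measurable_fun setT (phi : borel_boundary xi0 -> R).
Proof.
move=> /continuousP cphi; apply: (measurability _ (RGenOInfty.measurableE R)).
move=> _ [_ [x ->] <-]; rewrite setTI; apply: open_measurable_boundary.
by apply: cphi; exact: interval_open.
Qed.

Lemma group_countable : countable [set: G].
Proof.
have -> : [set: G] = \bigcup_(n : nat) [set g | mdist o (a g o) <= n%:R].
  apply/seteqP; split=> // g _.
  by exists (Num.truncn (mdist o (a g o))).+1 => //=; exact/ltW/truncnS_gt.
by apply: bigcup_countable => // n _; exact/finite_set_countable/orbit_finite.
Qed.

Lemma continuous_act phi g : continuous phi -> continuous (phi \o bact g).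
Proof.
move=> cphi xi; apply: continuous_comp; last exact: cphi.
exact: (boundary_act_continuous delta_ge0 hyp).
Qed.

Lemma integral_stationary phi n : continuous phi -> (forall xi, 0 <= phi xi) ->
  measurable_fun setT ((fun xi => ex (cp n) (fun g => phi (bact g xi))) :
    borel_boundary xi0 -> R) /\
  (\int[nu]_xi (ex (cp n) (fun g => phi (bact g xi)))%:E = \int[nu]_xi (phi
    xi)%:E)%E.
Proof.
move=> cphi phi0; have [M M0 MP] := continuous_bounded cphi.
have [f [e [finj ef fe]]] := countable_enum group_countable.
have cp0 g : 0 <= cp n g := (cpP n).1 g.
have mphi := continuous_measurable_boundary cphi.
have mact g : measurable_fun setT (bact g : borel_boundary xi0 -> borel_boundary
  xi0).
  exact: (boundary_act_measurable a delta_ge0 hyp).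
have mphig g : measurable_fun setT ((fun xi => phi (bact g xi)) : borel_boundary
  xi0 -> R).
  exact: (continuous_measurable_boundary (continuous_act cphi)).
pose F (k : nat) (xi : borel_boundary xi0) : R :=
  oapp (fun g => phi (bact g xi) * cp n g) 0 (e k).
have exE xi : ((ex (cp n) (fun g => phi (bact g xi)))%:E =
    \sum_(0 <= k <oo) (F k xi)%:E)%E.
  rewrite exE_ge0//; last by exists M.
  rewrite (esum_enum finj ef fe)//; last by move=> g; rewrite lee_fin mulr_ge0.
  by apply: eq_eseriesr => k _; rewrite /F; case: (e k).
have F0 k xi : 0 <= F k xi.
  by rewrite /F; case: (e k) => [g|]//=; rewrite mulr_ge0.
have mF k : measurable_fun setT (F k).
  rewrite /F; case: (e k) => [g|]/=; last exact: measurable_cst.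
  apply: measurable_funM => //; exact: mphig.
have mEF k : measurable_fun setT (fun xi : borel_boundary xi0 => (F k xi)%:E) by
  exact/measurable_EFinP.
split.
  apply/measurable_EFinP; rewrite [X in measurable_fun _ X](_ : _ =
    fun xi => \sum_(0 <= k <oo) (F k xi)%:E)%E; last first.
    by apply/funext => xi /=; rewrite exE.
  by apply: ge0_emeasurable_sum => // k xi _ _; rewrite lee_fin.
rewrite (eq_integral (fun xi : borel_boundary xi0 => \sum_(0 <= k <oo) (F k
  xi)%:E)%E); last first.
  by move=> xi _; rewrite exE.
rewrite integral_nneseries//; last by move=> k xi _; rewrite lee_fin.
have /choice[m mP] : forall k, exists m : {measure set (borel_boundary xi0) ->
  \bar R},
    (forall A, m A = oapp (fun g => (cp n g)%:E * nu (bact g @^-1` A))%E 0%E (e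
      k)) /\
    (\int[m]_xi (phi xi)%:E = \int[nu]_xi (F k xi)%:E)%E.
  move=> k; rewrite /F; case: (e k) => [g|]/=.
    unshelve epose (pf := (pushforward nu
      (bact g : borel_boundary xi0 -> borel_boundary xi0) :
      {measure set (borel_boundary xi0) -> \bar R})).
      exact: mact.
    exists (mscale (NngNum (cp0 g)) pf); split=> //.
    rewrite ge0_integral_mscale//; last 2 first.
    - exact/measurable_EFinP.
    - by move=> xi _; rewrite lee_fin.
    rewrite ge0_integral_pushforward//; last 2 first.
    - exact/measurable_EFinP.
    - by move=> xi _; rewrite lee_fin.
    rewrite preimage_setT -ge0_integralZl//.
    - by apply: eq_integral => xi _; rewrite -EFinM mulrC.
    - by apply/measurable_EFinP; exact: mphig.
    - by move=> xi _; rewrite lee_fin.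
  by exists mzero; split=> //; rewrite integral_measure_zero integral0.
transitivity (\sum_(0 <= k <oo) \int[m k]_xi (phi xi)%:E)%E.
  by apply: eq_eseriesr => k _; have [_ ->] := mP k.
rewrite -ge0_integral_measure_series//; last 2 first.
- by move=> xi _; rewrite lee_fin.
- exact/measurable_EFinP.
apply: eq_measure_integral => A mA _; rewrite /mseries.
transitivity (\sum_(0 <= k <oo)
    oapp (fun g => (cp n g)%:E * nu (bact g @^-1` A)) 0 (e k))%E.
  by apply: eq_eseriesr => k _; have [-> _] := mP k.
have mgA g : measurable (bact g @^-1` A : set (borel_boundary xi0)).
  exact: (measurable_boundary_act_preimage a delta_ge0 hyp).
rewrite -(esum_enum finj ef fe); last first.
  by move=> g; rewrite mule_ge0// lee_fin.
rewrite -[RHS]fineK ?fin_num_measure//.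
rewrite -(stationary_ex delta_ge0 hyp mu_prob nu_stationary n mA) exE_ge0//.
- by apply: eq_esum => g _; rewrite EFinM muleC fineK// fin_num_measure.
- by move=> g; exact: fine_ge0.
- exists 1 => g; have /andP[? ?] := fine_prob_le1 nu (mgA g).
  by rewrite ger0_norm.
Qed.

Lemma bounded_integrable (f : borel_boundary xi0 -> R) :
  measurable_fun setT f -> bounded_fam f -> nu.-integrable setT (EFin \o f).
Proof.
move=> mf [M fM]; apply: measurable_bounded_integrable => //.
  by apply: le_lt_trans (ltry 1); exact: probability_le1.
by exists M; split=> [|x /ltW Mx t _]; [exact: num_real|exact: le_trans (fM t)
  Mx].
Qed.

Lemma Rintegral_cst_prob c : \int[nu]_(_ in setT) c = c.
Proof.
rewrite Rintegral_cst//; have nu1 : fine (nu setT) = 1 by rewrite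
  probability_setT.
by rewrite -[RHS]mulr1 -nu1.
Qed.

Lemma Rintegral_stationary phi n : continuous phi ->
  measurable_fun setT ((fun xi => ex (cp n) (fun g => phi (bact g xi))) :
    borel_boundary xi0 -> R) /\
  \int[nu]_x (ex (cp n) (fun g => phi (bact g x))) = \int[nu]_x phi x.
Proof.
move=> cphi; have [M M0 MP] := continuous_bounded cphi.
have bphi x : bounded_fam (fun g => phi (bact g x)) by exists M.
have cphiM : continuous (fun x => phi x + M).
  by move=> x; exact: (@cvgD _ _ _ (nbhs x) _ phi (fun=> M) _ _ (cphi x)
    (cvg_cst M)).
have phiM0 x : 0 <= phi x + M.
  by have := MP x; rewrite ler_norml => /andP[h _]; lra.
have [mh Ih] := integral_stationary n cphiM phiM0.
have exM x : ex (cp n) (fun g => phi (bact g x) + M) =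
    ex (cp n) (fun g => phi (bact g x)) + M.
  by rewrite exD ?ex_cst//; exact: bounded_fam_cst.
have mh' : measurable_fun setT ((fun x => ex (cp n) (fun g => phi (bact g x))) :
    borel_boundary xi0 -> R).
  rewrite [X in measurable_fun _ X](_ : _ = (fun x : borel_boundary xi0 =>
    ex (cp n) (fun g => phi (bact g x) + M) - M)); last first.
    by apply/funext => x; rewrite exM addrK.
  by apply: measurable_funB => //; exact: measurable_cst.
split=> //; apply: (addIr M).
have bh : bounded_fam ((fun x => ex (cp n) (fun g => phi (bact g x))) :
    borel_boundary xi0 -> R).
  by exists M => x; apply: ex_bound.
have ic : nu.-integrable setT (EFin \o (fun _ : borel_boundary xi0 => M)).
  by apply: bounded_integrable => //; exact: bounded_fam_cst.
have IM (f : borel_boundary xi0 -> R) : nu.-integrable setT (EFin \o f) ->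
    \int[nu]_x f x + M = \int[nu]_x (f x + M).
  by move=> fi; rewrite RintegralD// Rintegral_cst_prob.
rewrite !IM; last 2 first.
- apply: bounded_integrable; last by exists M.
  exact: continuous_measurable_boundary.
- exact: bounded_integrable.
rewrite /Rintegral -Ih; congr fine.
by apply: eq_integral => x _; rewrite exM.
Qed.

(** By contraction, the mean of [phi (g x)] under [cp n] varies by at most [e] as a function of [x].
    Its integral against [nu] is that of [phi], so each of its values is within [e] of that
    integral. *)
Lemma mean_converges phi e : continuous phi -> 0 < e ->
  exists N, forall n, (N <= n)%N -> forall xi,
  `|ex (cp n) (fun g => phi (bact g xi)) - \int[nu]_x phi x| <= e.
Proof.
move=> cphi e0; have [M M0 MP] := continuous_bounded cphi.
have bphi x : bounded_fam (fun g => phi (bact g x)) by exists M.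
have [N NP] := contraction cphi e0.
exists N => n Nn xi; have [mh Ih] := Rintegral_stationary n cphi.
have ih : nu.-integrable setT (EFin \o ((fun x => ex (cp n) (fun g => phi (bact
  g x))) :
    borel_boundary xi0 -> R)).
  by apply: bounded_integrable => //; exists M => x; apply: ex_bound.
have ic c : nu.-integrable setT (EFin \o (fun _ : borel_boundary xi0 => c)).
  by apply: bounded_integrable => //; exact: bounded_fam_cst.
have close x : `|ex (cp n) (fun g => phi (bact g xi)) -
    ex (cp n) (fun g => phi (bact g x))| <= e.
  rewrite -exB//; apply: le_trans (NP n Nn xi x).
  by apply: ex_abs => //; exact: bounded_famB.
rewrite -Ih ler_norml; apply/andP; split.
  rewrite lerNl opprB lerBlDr -[leRHS]Rintegral_cst_prob.
  apply: le_Rintegral => // x _.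
  by have := close x; rewrite ler_norml => /andP[? ?]; lra.
rewrite lerBlDr -lerBlDl -[leLHS]Rintegral_cst_prob.
apply: le_Rintegral => // x _.
by have := close x; rewrite ler_norml => /andP[? ?]; lra.
Qed.

Theorem product_converges phi psi xi eta e : continuous phi -> continuous psi ->
  0 < e -> exists N, forall n, (N <= n)%N ->
  `|ex (cp n) (fun g => phi (bact g xi) * psi (bact g^-1%g eta)) -
    (\int[nu]_x phi x) * (\int[nu]_x psi x)| <= e.
Proof.
move=> cphi cpsi e0; set I := \int[nu]_x phi x; set J := \int[nu]_x psi x.
have [M M0 MP] := continuous_bounded cphi.
have [L L0 LP] := continuous_bounded cpsi.
(* The errors add up to [d * (L + M)] for decoupling the two factors and [M * d + d * |J|] for
   replacing the means by the integrals. *)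
pose d := e / (2 * M + L + `|J| + 1).
have K0 : 0 < 2 * M + L + `|J| + 1 by have := normr_ge0 J; lra.
have d0 : 0 < d by rewrite divr_gt0.
have [N1 N1P] := contraction cphi d0; have [N2 N2P] := contraction cpsi d0.
have [N3 N3P] := mean_converges cphi d0; have [N4 N4P] := mean_converges cpsi
  d0.
pose N := maxn (maxn N1 N2) (maxn N3 N4).
have [N1N N2N N3N N4N] : [/\ N1 <= N, N2 <= N, N3 <= N & N4 <= N]%N.
  by split; rewrite /N !leq_max leqnn ?orbT.
exists (N + N)%N => n Nn.
(* The cut need not be in the middle: both pieces only have to be at least [N] steps long. *)
pose p := N; pose q := (n - N)%N.
have Nq : (N <= q)%N by rewrite /q leq_subRL ?(leq_trans _ Nn)// leq_addr.
have -> : n = (p + q)%N by rewrite /p /q subnKC// (leq_trans _ Nn)// leq_addr.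
have bphi h z : bounded_fam (fun g => phi (bact (g * h)%g z)) by exists M.
have bpsi h z : bounded_fam (fun g => psi (bact (h * g^-1)%g z)) by exists L.
set A := ex (cp p) (fun g => phi (bact g xi)).
set B := ex (cp q) (fun g => psi (bact g^-1%g eta)).
have AI : `|A - I| <= d by apply: N3P.
have BJ : `|B - J| <= d.
  rewrite /B (ex_convolution_powerV mu_prob _ mu_sym (f := fun g => psi (bact g
    eta))).
    by apply: N4P; exact: leq_trans Nq.
  by exists L.
have AM : `|A| <= M by apply: ex_bound.
pose F g h := phi (bact (g * h)%g xi) * psi (bact (g * h)^-1%g eta).
pose F0 g h := phi (bact g xi) * psi (bact h^-1%g eta).
have FM g h : `|F g h| <= M * L by rewrite normrM ler_pM.
have F0M g h : `|F0 g h| <= M * L by rewrite normrM ler_pM.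
have EF : ex (cp (p + q)) (fun g => phi (bact g xi) * psi (bact g^-1%g eta)) =
    ex (cp p) (fun g => ex (cp q) (F g)).
  rewrite (ex_convolution_powerD mu_prob)//.
  by exists (M * L) => g; rewrite normrM ler_pM.
have EF0 : A * B = ex (cp p) (fun g => ex (cp q) (F0 g)).
  rewrite mulrC /A -exZ//; last by exists M.
  apply: eq_ex => g; rewrite /F0 exZ// 1?mulrC//; by exists L.
have close : `|ex (cp p) (fun g => ex (cp q) (F g)) - A * B| <= d * (L + M).
  rewrite EF0 -exB//; last 2 first.
  - by exists (M * L) => g; apply: ex_bound.
  - by exists (M * L) => g; apply: ex_bound.
  (* [D1] is the error of replacing [h xi] by [xi] under [g], small after averaging over [g]; [D2]
     is that of replacing [g^-1 eta] by [eta] under [h^-1], small after averaging over [h]. *)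
  pose D1 g h := `|phi (bact g (bact h xi)) - phi (bact g xi)|.
  pose D2 g h := `|psi (bact h^-1%g (bact g^-1%g eta)) - psi (bact h^-1%g eta)|.
  have D1M g h : `|D1 g h| <= M + M.
    by rewrite normr_id (le_trans (ler_normB _ _))// lerD.
  have D2M g h : `|D2 g h| <= L + L.
    by rewrite normr_id (le_trans (ler_normB _ _))// lerD.
  have bD1 g : bounded_fam (D1 g) by exists (M + M).
  have bD2 g : bounded_fam (D2 g) by exists (L + L).
  have bLD1 g : bounded_fam (fun h => L * D1 g h).
    by apply: bounded_famM => //; exact: bounded_fam_cst.
  have bMD2 g : bounded_fam (fun h => M * D2 g h).
    by apply: bounded_famM => //; exact: bounded_fam_cst.
  have beD1 : bounded_fam (fun g => ex (cp q) (D1 g)).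
    by exists (M + M) => g; apply: ex_bound.
  have bF g : bounded_fam (F g) by exists (M * L).
  have bF0 g : bounded_fam (F0 g) by exists (M * L).
  have beF : bounded_fam (fun g => ex (cp q) (F g) - ex (cp q) (F0 g)).
    by apply: bounded_famB; exists (M * L) => g; apply: ex_bound.
  have inner g : `|ex (cp q) (F g) - ex (cp q) (F0 g)| <= L * ex (cp q) (D1 g) +
    M * d.
    rewrite -exB//; apply: le_trans (ex_abs (cpP q) _) _;
      first exact: bounded_famB.
    apply: (@le_trans _ _ (ex (cp q) (fun h => L * D1 g h + M * D2 g h))).
      apply: ex_le => //; [|exact: bounded_famD|].
        by apply: bounded_fam_abs; exact: bounded_famB.
      move=> h; rewrite /F /F0 /D1 /D2 invgM !(boundary_actM _ hyp).
      set u := phi (bact g (bact h xi)); set v := psi (bact h^-1%g (bact g^-1%g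
        eta)).
      set u0 := phi (bact g xi); set v0 := psi (bact h^-1%g eta).
      have -> : u * v - u0 * v0 = (u - u0) * v + u0 * (v - v0) by ring.
      rewrite (le_trans (ler_normD _ _))// !normrM lerD//.
        by rewrite mulrC ler_wpM2r// LP.
      by rewrite ler_wpM2r// MP.
    rewrite exD// !exZ// lerD2l ler_wpM2l//; first exact: ltW.
    have -> : ex (cp q) (D2 g) = ex (cp q) (fun h =>
        `|psi (bact h (bact g^-1%g eta)) - psi (bact h eta)|).
      rewrite -[RHS](ex_convolution_powerV mu_prob _ mu_sym)//.
      exists (L + L) => h.
      by rewrite normr_id (le_trans (ler_normB _ _))// lerD.
    by apply: N2P; exact: leq_trans Nq.
  apply: le_trans (ex_abs (cpP p) beF) _.
  apply: (@le_trans _ _ (ex (cp p) (fun g => L * ex (cp q) (D1 g) + M * d))).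
    apply: ex_le => //; first exact: bounded_fam_abs.
    apply: bounded_famD; last exact: bounded_fam_cst.
    by apply: bounded_famM => //; exact: bounded_fam_cst.
  rewrite exD//; last 2 first.
  - by apply: bounded_famM => //; exact: bounded_fam_cst.
  - exact: bounded_fam_cst.
  (* In [D1] it is [g] that contracts, for each fixed [h], so the order of averaging is exchanged
     first. *)
  rewrite ex_cst// exZ// ex_swap//; last by exists (M + M) => -[g h].
  rewrite mulrDr (mulrC d L) (mulrC d M) lerD2r ler_wpM2l//; first exact: ltW.
  apply: (@le_trans _ _ (ex (cp q) (fun=> d))); last by rewrite ex_cst.
  apply: ex_le => //; last by move=> h; exact: N1P.
  - by exists (M + M) => h; apply: ex_bound.
  - exact: bounded_fam_cst.
rewrite EF.
have dE : d * (2 * M + L + `|J| + 1) = e by rewrite divfK// gt_eqF.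
have h1 : `|A * B - I * J| <= M * d + d * `|J|.
  have -> : A * B - I * J = A * (B - J) + (A - I) * J by ring.
  rewrite (le_trans (ler_normD _ _))// !normrM lerD//; first exact: ler_pM.
  by rewrite ler_wpM2r.
have := ler_normD (ex (cp p) (fun g => ex (cp q) (F g)) - A * B) (A * B - I *
  J).
by rewrite addrA subrK; lra.
Qed.

End Equidistribution.

(** * The law of the random walk *)

Section RandomWalkLaw.
Context {R : realType} {G : groupType} {d : measure_display}.
Context {Omega : measurableType d}.
Variables (P : probability Omega R) (mu : G -> R) (H : nat -> Omega -> G).
Hypothesis mu_prob : probability_on mu.
Hypothesis H_iid : iid_with_law P mu H.
Hypothesis G_countable : countable [set: G].
Local Notation cp := (convolution_power mu).
Local Notation walk := (random_walk H).

Lemma random_walk0 w : walk 0 w = 1%g.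
Proof. by rewrite /random_walk big_ord0. Qed.

Lemma random_walkS n w : walk n.+1 w = (walk n w * H n w)%g.
Proof. by rewrite /random_walk big_ord_recr. Qed.

Lemma fibers_measurable (Y : Omega -> G) (E : G -> set Omega) :
  (forall g, measurable (Y @^-1` [set g])) -> (forall g, measurable (E g)) ->
  measurable [set w | E (Y w) w].
Proof.
move=> mY mE; have [f [e [finj ef fe]]] := countable_enum G_countable.
have -> : [set w | E (Y w) w] =
    \bigcup_k oapp (fun g => Y @^-1` [set g] `&` E g) set0 (e k).
  apply/seteqP; split=> [w Ew|w [k _]]; first by exists (f (Y w)) => //;
    rewrite ef.
  by case: (e k) => //= g [/= <-].
apply: bigcupT_measurable => k; case: (e k) => [g|]//=.
exact: measurableI.
Qed.

Lemma measure_fibers (Y : Omega -> G) (E : G -> set Omega) :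
  (forall g, measurable (Y @^-1` [set g])) -> (forall g, measurable (E g)) ->
  (P [set w | E (Y w) w] = \esum_(g in [set: G]) P (Y @^-1` [set g] `&` E g))%E.
Proof.
move=> mY mE; have [f [e [finj ef fe]]] := countable_enum G_countable.
rewrite (esum_enum finj ef fe)//.
have -> : [set w | E (Y w) w] =
    \bigcup_k oapp (fun g => Y @^-1` [set g] `&` E g) set0 (e k).
  apply/seteqP; split=> [w Ew|w [k _]]; first by exists (f (Y w)) => //;
    rewrite ef.
  by case: (e k) => //= g [/= <-].
rewrite measure_bigcup//=; last 2 first.
- by move=> k _; case: (e k) => [g|]//=; exact: measurableI.
- move=> i j _ _ [w []]; case ei : (e i) => [g|]//= [/= gw _].
  case ej : (e j) => [h|]//= [/= hw _].
  by rewrite -(fe _ _ ei) -(fe _ _ ej) -gw -hw.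
rewrite (eq_eseriesl (Q := xpredT)); last by move=> k; rewrite in_setT.
by apply: eq_eseriesr => k _; case: (e k) => [g|]//=; rewrite measure0.
Qed.

Lemma random_walk_measurable n (A : set G) : measurable (walk n @^-1` A).
Proof.
have [mH _ _] := H_iid; elim: n A => [|n IH] A.
  have [A1|nA1] := pselect (A 1%g).
    have -> : walk 0 @^-1` A = setT.
      by apply/seteqP; split=> // w _; rewrite /= random_walk0.
    exact: measurableT.
  have -> : walk 0 @^-1` A = set0.
    by apply/seteqP; split=> // w; rewrite /= random_walk0.
  exact: measurable0.
have -> : walk n.+1 @^-1` A =
    [set w | (H n @^-1` [set h | A (walk n w * h)%g]) w].
  by apply/seteqP; split=> w /=; rewrite random_walkS.
apply: (@fibers_measurable (walk n) (fun g => H n @^-1` [set h | A (g * h)%g]))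
  => g.
  exact: IH.
exact: mH.
Qed.

(** Independence is given only for the increments. To obtain it for [X_n] and the next increment,
    the induction carries an arbitrary event on finitely many later increments; those start at index
    [n], since [X_n] uses the indices below [n]. *)
Lemma random_walk_joint_law n g (I : {fset nat}) (A : nat -> set G) :
  (forall i, i \in I -> (n <= i)%N) ->
  P (walk n @^-1` [set g] `&` \bigcap_(i in [set` I]) H i @^-1` A i) =
  ((cp n g)%:E * P (\bigcap_(i in [set` I]) H i @^-1` A i))%E.
Proof.
have [mH lawH indH] := H_iid.
have mI (J : {fset nat}) (B : nat -> set G) :
    measurable (\bigcap_(i in [set` J]) H i @^-1` B i).
  by apply: fin_bigcap_measurable => // i _; exact: mH.
elim: n g I A => [|n IH] g I A In.
  rewrite /convolution_power/=; case: eqP => [->|ne].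
    rewrite mul1e; congr (P _); apply/seteqP; split=> w /=; first by case.
    by move=> h; split=> //; exact: random_walk0.
  rewrite mul0e -[RHS](measure0 P); congr (P _); apply/seteqP;
    split=> w //= [gw].
  by exfalso; apply: ne; rewrite -gw random_walk0.
pose E h := H n @^-1` [set (h^-1 * g)%g] `&` \bigcap_(i in [set` I]) H i @^-1` A
  i.
have mE h : measurable (E h) by apply: measurableI; [exact: mH|exact: mI].
have -> : walk n.+1 @^-1` [set g] `&` \bigcap_(i in [set` I]) H i @^-1` A i =
    [set w | E (walk n w) w].
  apply/seteqP; split=> w /=; rewrite random_walkS => -[gw Iw]; split=> //=.
    by rewrite -gw mulKg.
  by rewrite gw mulVKg.
rewrite measure_fibers//; last by move=> h; exact: random_walk_measurable.
have nI : n \notin I by apply/negP => /In; rewrite ltnn.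
have PE h : P (walk n @^-1` [set h] `&` E h) =
    ((cp n h)%:E * ((mu (h^-1 * g)%g)%:E * P (\bigcap_(i in [set` I]) H i @^-1`
      A i)))%E.
  (* On the event that [X_n = h], reaching [g] at the next time is a condition on the increment [n].
     It joins the later events, to which the induction hypothesis applies. *)
  pose B i := if i == n then [set (h^-1 * g)%g] else A i.
  have EB : E h = \bigcap_(i in [set` (n |` I)%fset]) H i @^-1` B i.
    apply/seteqP; split=> [w [/= hn hI] i /=|w hB].
      rewrite !inE /B => /predU1P[->|iI]; first by rewrite eqxx.
      by case: eqP => [iE|_]; [rewrite -iE iI in nI|exact: hI].
    split; first by have := hB n; rewrite /= /B eqxx; apply; rewrite !inE eqxx.
    move=> i /= iI; have := hB i; rewrite /= /B; case: eqP => [iE|_].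
      by rewrite -iE iI in nI.
    by apply; rewrite !inE iI orbT.
  rewrite EB IH; last first.
    by move=> i; rewrite !inE => /predU1P[->|/In /ltnW].
  rewrite !indH big_fsetU1//= /B eqxx lawH; congr (_ * (_ * _))%E.
  apply: eq_fbigr => i iI _; case: eqP => // iE.
  by rewrite -iE iI in nI.
rewrite (eq_esum (fun h _ => PE h)).
have cpn := convolution_power_prob mu_prob n.
set c := P _; have cfin : c \is a fin_num by rewrite fin_num_measure.
have c0 : 0 <= fine c by apply: fine_ge0; exact: measure_ge0.
rewrite -(fineK cfin) muleC convolution_powerS convolutionE// -esumZl//.
  by apply: eq_esum => h _; rewrite -!EFinM mulrA mulrC.
by move=> h; rewrite lee_fin mulr_ge0 ?mu_prob.1 ?cpn.1.
Qed.

Lemma random_walk_law n g : P (walk n @^-1` [set g]) = (cp n g)%:E.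
Proof.
have := @random_walk_joint_law n g fset0 (fun=> setT) ltac:(by []).
have -> : \bigcap_(i in [set` fset0]) H i @^-1` setT = setT by apply/seteqP;
  split.
by rewrite setIT probability_setT mule1.
Qed.

Lemma expectation_random_walk n (F : G -> R) : bounded_fam F ->
  ('E_P[fun w => F (walk n w)] = (gsum (fun g => F g * cp n g))%:E)%E.
Proof.
move=> bF; have cpn := convolution_power_prob mu_prob n.
have mF (F' : G -> R) : measurable_fun setT (fun w => F' (walk n w)).
  move=> _ B mB; rewrite setTI.
  exact: (random_walk_measurable n (F' @^-1` B)).
have mw g : measurable (walk n @^-1` [set g]) by exact: random_walk_measurable.
have ge0 (F' : G -> R) : (forall g, 0 <= F' g) ->
    (\int[P]_w (F' (walk n w))%:E = \esum_(g in [set: G]) (F' g * cp n g)%:E)%E.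
  move=> F0; have [f [e [finj ef fe]]] := countable_enum G_countable.
  pose D k := oapp (fun g => walk n @^-1` [set g]) set0 (e k).
  have UD : setT = \bigcup_k D k.
    by apply/seteqP; split=> // w _; exists (f (walk n w)) => //; rewrite /D ef.
  rewrite UD ge0_integral_bigcup; last 4 first.
  - by move=> k; rewrite /D; case: (e k) => [g|]//=.
  - by rewrite -UD; apply/measurable_EFinP; exact: mF.
  - by move=> w _; rewrite lee_fin.
  - move=> i j _ _ [w []]; rewrite /D; case ei : (e i) => [g|]//= gw.
    case ej : (e j) => [h|]//= hw.
    by rewrite -(fe _ _ ei) -(fe _ _ ej) -gw -hw.
  rewrite (esum_enum finj ef fe)//; last first.
    by move=> g; rewrite lee_fin mulr_ge0 ?cpn.1.
  apply: eq_eseriesr => k _; rewrite /D; case: (e k) => [g|]/=; last first.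
    by rewrite integral_set0.
  rewrite (eq_integral (cst (F' g)%:E)); last by move=> w; rewrite inE /= => ->.
  rewrite integral_cst// EFinM; congr (_ * _)%E.
  exact: random_walk_law.
rewrite unlock integralE -[gsum _]/(gsum (fun g => F g * cp n g)).
have -> : gsum (fun g => F g * cp n g) = ex (cp n) F by rewrite ex.unlock.
rewrite ex_posneg// EFinB !exE_ge0//; last 4 first.
- by move=> g; rewrite le_max lexx orbT.
- exact/bounded_fam_maxr/bounded_famN.
- by move=> g; rewrite le_max lexx orbT.
- exact: bounded_fam_maxr.
rewrite -(ge0 (fun g => Num.max (F g) 0)); last by move=> g;
  rewrite le_max lexx orbT.
rewrite -(ge0 (fun g => Num.max (- F g) 0)); last by move=> g;
  rewrite le_max lexx orbT.
by congr (_ - _)%E; apply: eq_integral => w _;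
  rewrite ?funeposE ?funenegE -?EFinN -EFin_max.
Qed.

End RandomWalkLaw.

Theorem theorem1 (R : realType) (G : groupType) (X : metricType R) (o : X)
    (a : isom_action G X) (xi0 : boundary o)
    (nu : probability (borel_boundary xi0) R) (mu : G -> R)
    (X_proper : proper_space X) (X_geodesic : roughly_geodesic X)
    (X_hyperbolic : hyperbolic X)
    (G_nonelementary : ~ virtually_cyclic [set: G])
    (a_proper : proper_action a)
    (mu_probability : probability_on mu)
    (mu_symmetric : symmetric_measure mu)
    (mu_nonelementary : nonelementary_measure mu)
    (mu_ergodic : ergodic_for a mu nu)
    (mu_moment : first_moment a o mu)
    (d : measure_display) (Omega : measurableType d) (P : probability Omega R)
    (H : nat -> Omega -> G) (H_iid : iid_with_law P mu H)
    (phi psi : boundary o -> R)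
    (phi_continuous : continuous phi) (psi_continuous : continuous psi)
    (xi eta : boundary o) :
  (forall n : nat,
    'E_P[fun w => (phi (boundary_act a (random_walk H n w) xi) *
                   psi (boundary_act a (random_walk H n w)^-1%g eta))%R]%E =
    (gsum (fun g => phi (boundary_act a g xi) * psi (boundary_act a g^-1%g eta)
                    * convolution_power mu n g))%:E) /\
  (gsum (fun g => phi (boundary_act a g xi) * psi (boundary_act a g^-1%g eta)
                  * convolution_power mu n g)) @[n --> \oo] -->
    (\int[nu]_x phi x) * (\int[nu]_x psi x).
Proof.
have [delta delta_ge0 hyp] := X_hyperbolic; have [C rough] := X_geodesic.
have [nu_stationary _] := mu_ergodic.
have [M M0 MP] := continuous_bounded delta_ge0 hyp X_proper rough
  phi_continuous.
have [L L0 LP] := continuous_bounded delta_ge0 hyp X_proper rough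
  psi_continuous.
split=> [n|].
  apply: (expectation_random_walk mu_probability H_iid (group_countable o
    X_proper a_proper)
    n (F := fun g => phi (boundary_act a g xi) * psi (boundary_act a g^-1%g
      eta))).
  by exists (M * L) => g; rewrite normrM ler_pM.
apply/cvgrPdist_le => e e0.
have [N NP] := product_converges delta_ge0 hyp mu_probability mu_symmetric
  nu_stationary X_proper
  a_proper mu_nonelementary rough xi eta phi_continuous psi_continuous e0.
exists N => // n /= /NP; rewrite ex.unlock distrC; exact.
Qed.
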